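(* For every $\nu>0$ and $n\ge1$, the function $T_\nu$ has exactly one critical point $\alpha_{\nu,n}\in(\kappa_{\nu,n+1},\kappa_{\nu,n})$, which is the unique minimum of $T_\nu$ on $(\kappa_{\nu,n+1},\kappa_{\nu,n})$. If $\tau_{\nu,n}=T_\nu(\alpha_{\nu,n})$, then $0<\tau_{\nu,1}<\tau_{\nu,2}<\ldots$ and $\tau_{\nu,n}\to\infty$ as $n\to\infty$. Consequently, for all $\nu>0$, $n\ge1$ and $x\in(\kappa_{\nu,n+1},\kappa_{\nu,n})$, $$K_{\mathrm i\nu-1}(x)K_{\mathrm i\nu+1}(x)-K_{\mathrm i\nu}^2(x)\ge\tau_{\nu,n}\,K_{\mathrm i\nu}^2(x),$$ and the constant $\tau_{\nu,n}$ is best possible.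
   Context: $K_\mu$ is the modified Bessel function of the second kind of complex order $\mu$; for $x>0$, $K_\mu(x)=\int_0^\infty e^{-x\cosh t}\cosh(\mu t)\,dt$. For $\nu>0$ the function $x\mapsto K_{\mathrm i\nu}(x)$ is real on $(0,\infty)$ and has infinitely many positive zeros, all simple, accumulating only at $0$; they are denoted in decreasing order by $\kappa_{\nu,1}>\kappa_{\nu,2}>\ldots>\kappa_{\nu,n}>\ldots>0$. Where $K_{\mathrm i\nu}(x)\neq0$, $$T_\nu(x)=\frac{K_{\mathrm i\nu-1}(x)K_{\mathrm i\nu+1}(x)}{K_{\mathrm i\nu}^2(x)}-1,$$ which is real-valued since $K_{\mathrm i\nu-1}(x)=\overline{K_{1+\mathrm i\nu}(x)}$ for $x>0$. *)

(* Defs.v *)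
From Stdlib Require Import Reals.
From Coquelicot Require Import Coquelicot.

Open Scope R_scope.

Definition Cexp (z : C) : C := (exp (Re z) * cos (Im z), exp (Re z) * sin (Im z)).

Definition Ccosh (z : C) : C := ((Cexp z + Cexp (- z)) / 2)%C.

(* Modified Bessel function of the second kind of complex order [mu], for
   [x > 0]; the improper Riemann integral is taken in [C] as a real Banach
   space. *)
Definition BesselK (mu : C) (x : R) : C :=
  RInt_gen (V := C_R_CompleteNormedModule)
    (fun t : R => (RtoC (exp (- x * cosh t)) * Ccosh (mu * RtoC t))%C)
    (at_point 0) (Rbar_locally p_infty).

(* [kappa nu n], for [n >= 1], is the [n]-th largest positive zero of
   [K_{i nu}]: the supremum defining it is attained, since the zeros accumulate
   only at 0.  The value at [n = 0] is a dummy. *)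
Fixpoint kappa (nu : R) (n : nat) : R :=
  match n with
  | O => 0
  | S m => real (Lub_Rbar (fun x : R =>
             0 < x /\ BesselK (Ci * RtoC nu)%C x = RtoC 0 /\
             (m = O \/ x < kappa nu m)))
  end.

(* [K_{i nu - 1} K_{i nu + 1} / K_{i nu}^2 - 1] is real for [x > 0] with
   [K_{i nu} x <> 0], so that [Re] only changes the type. *)
Definition Tnu (nu x : R) : R :=
  Re (BesselK (Ci * RtoC nu - 1)%C x * BesselK (Ci * RtoC nu + 1)%C x
      / (BesselK (Ci * RtoC nu)%C x * BesselK (Ci * RtoC nu)%C x) - 1)%C.

(* The order of the reals inside the complex numbers: [Cle 0 z] forces [z] to
   be real. *)
Definition Cle (z w : C) : Prop := Im z = Im w /\ Re z <= Re w.

Definition zero_gap (nu : R) (n : nat) (x : R) : Prop :=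
  kappa nu (S n) < x < kappa nu n.

Definition critical_point_on (I : R -> Prop) (f : R -> R) (a : R) : Prop :=
  I a /\ is_derive f a 0.

Definition minimum_point_on (I : R -> Prop) (f : R -> R) (a : R) : Prop :=
  I a /\ forall x : R, I x -> f a <= f x.

Definition turan_bound (nu c x : R) : Prop :=
  Cle (RtoC c * (BesselK (Ci * RtoC nu) x * BesselK (Ci * RtoC nu) x))%C
      (BesselK (Ci * RtoC nu - 1) x * BesselK (Ci * RtoC nu + 1) x
       - BesselK (Ci * RtoC nu) x * BesselK (Ci * RtoC nu) x)%C.

(* Main.v *)
Require Import Defs.
From Stdlib Require Import Reals Lra Lia Classical ClassicalEpsilon.
From Coquelicot Require Import Coquelicot.

(** Write [f] for [K_{i nu}] on the positive reals.  Differentiating under the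
    integral sign and integrating by parts give the modified Bessel equation
    [x (x f')' = (x^2 - nu^2) f] and [K_{i nu +- 1} = - f' +- i (nu / x) f]
    ([is_derive_Kim], [bessel_equation], [BesselK_imaginary_add1],
    [BesselK_imaginary_sub1]).  Hence [T_nu = D / (x f)^2] with
    [D = (x f')^2 + (nu^2 - x^2) f^2], and the equation collapses [D'] to
    [- 2 x f^2].  Since [D >= - x^2 f^2] and the right-hand side tends to [0] at
    infinity, the decreasing function [D] is positive ([scaled_turan_pos]).  So
    [T_nu] is positive and the zeros of [f] are simple.

    Put [P = D (1 + x f' / f + 1 / T_nu) = D (1 + x f' / f) + (x f)^2].  Then
    [T_nu' = - 2 P / (x^3 f^2)], and [P' = - D^2 / (x f^2)] is negative
    ([is_derive_Tnu], [is_derive_slope_factor]).  Between consecutive zeros [P]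
    is therefore strictly decreasing; the product [f P] extends continuously to
    both zeros, where its values have opposite signs because those of [f'] do.
    So [P] changes sign exactly once, from positive to negative, and [T_nu] has
    exactly one critical point, a strict minimum ([gap_minimum]).

    At that point [x f' / f = - 1 - 1 / T], while always
    [x^2 (T + 1) = (x f' / f)^2 + nu^2].  Thus [x^2 (T + 1) = (1 + 1 / T)^2 + nu^2],
    which makes the critical value [T] a decreasing function of the critical point
    [x], unbounded as [x] tends to [0] ([Tnu_critical_relation],
    [critical_values_increase], [critical_values_large]).  The critical points
    are separated by the zeros [kappa], which decrease to [0]: there are zeros
    arbitrarily close to [0] by Sturm comparison in the variable [ln x]
    ([arbitrarily_small_zeros]), none above [4 nu^2] ([Kim_pos]), and they are
    isolated. *)

(** * Integrals over the half-line *)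

Definition half_line_integral (g : R -> R) (l : R) : Prop :=
  is_RInt_gen g (at_point 0) (Rbar_locally p_infty) l.

Lemma eventually_above (b : R) (P : R * R -> Prop) :
  (forall v : R, b < v -> P (0, v)) ->
  filter_prod (at_point 0) (Rbar_locally p_infty) P.
Proof.
  intros H. exists (fun u => u = 0) (fun v => b < v).
  - reflexivity.
  - exists b. tauto.
  - intros u v -> Hv. now apply H.
Qed.

Lemma half_line_integral_of_limit (g G : R -> R) (l : R) :
  (forall b : R, is_RInt g 0 b (G b)) -> is_lim G p_infty l ->
  half_line_integral g l.
Proof.
  intros HG Hl P HP.
  destruct (Hl P HP) as [M HM].
  apply (eventually_above M). intros v Hv. exists (G v). split.
  - apply HG.
  - now apply HM.
Qed.

Lemma half_line_integral_primitive (g G : R -> R) (l : R) :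
  (forall t : R, is_derive G t (g t)) -> (forall t : R, continuous g t) ->
  is_lim G p_infty l -> half_line_integral g (l - G 0).
Proof.
  intros HG Hg Hl.
  apply half_line_integral_of_limit with (fun b => G b - G 0).
  - intros b. apply (is_RInt_derive (V := R_CompleteNormedModule)); intros t _; auto.
  - apply is_lim_minus with l (G 0); [exact Hl | apply is_lim_const | reflexivity].
Qed.

Lemma half_line_integral_ext (g h : R -> R) (l : R) :
  (forall t : R, 0 <= t -> g t = h t) ->
  half_line_integral g l -> half_line_integral h l.
Proof.
  intros E. apply is_RInt_gen_ext.
  apply (eventually_above 0). intros v Hv t. simpl.
  rewrite Rmin_left by lra. intros Ht. apply E. lra.
Qed.

Lemma half_line_integral_plus (g h : R -> R) (a b : R) :
  half_line_integral g a -> half_line_integral h b ->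
  half_line_integral (fun t => g t + h t) (a + b).
Proof. intros Hg Hh. exact (is_RInt_gen_plus _ _ _ _ Hg Hh). Qed.

Lemma half_line_integral_scal (k : R) (g : R -> R) (a : R) :
  half_line_integral g a -> half_line_integral (fun t => k * g t) (k * a).
Proof. intros Hg. exact (is_RInt_gen_scal _ k _ Hg). Qed.

Lemma half_line_integral_bound (g h : R -> R) (a b : R) :
  (forall t : R, 0 <= t -> Rabs (g t) <= h t) ->
  half_line_integral g a -> half_line_integral h b -> Rabs a <= b.
Proof.
  intros H Hg Hh.
  apply (RInt_gen_norm (V := R_CompleteNormedModule) (Fa := at_point 0)
           (Fb := Rbar_locally p_infty) g h a b); trivial.
  - apply (eventually_above 0). simpl. intros; lra.
  - apply (eventually_above 0). intros v Hv t Ht. apply H. exact (proj1 Ht).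
Qed.

Lemma half_line_integral_le (g h : R -> R) (a b : R) :
  (forall t : R, 0 <= t -> g t <= h t) ->
  half_line_integral g a -> half_line_integral h b -> a <= b.
Proof.
  intros H Hg Hh.
  assert (K : Rabs (0 * a) <= b + -1 * a).
  { apply half_line_integral_bound with (fun t => 0 * g t) (fun t => h t + -1 * g t).
    - intros t Ht. specialize (H t Ht). rewrite Rmult_0_l, Rabs_R0. lra.
    - now apply half_line_integral_scal.
    - apply half_line_integral_plus; trivial. now apply half_line_integral_scal. }
  rewrite Rmult_0_l, Rabs_R0 in K. lra.
Qed.

Lemma half_line_integral_RInt_gen (g : R -> R) (l : R) :
  half_line_integral g l ->
  RInt_gen g (at_point 0) (Rbar_locally p_infty) = l.
Proof.
  intros H.
  exact (is_RInt_gen_unique (V := R_CompleteNormedModule) g l H).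
Qed.

Lemma half_line_integral_unique (g : R -> R) (a b : R) :
  half_line_integral g a -> half_line_integral g b -> a = b.
Proof.
  intros Ha Hb. apply half_line_integral_RInt_gen in Ha, Hb. congruence.
Qed.

Lemma is_lim_exp_opp : is_lim (fun t => exp (- t)) p_infty 0.
Proof.
  apply is_lim_comp with m_infty.
  - apply is_lim_exp_m.
  - apply is_lim_ext with (fun t => -1 * t). { intros; ring. }
    replace m_infty with (Rbar_mult (-1) p_infty).
    + apply is_lim_scal_l, is_lim_id.
    + simpl. destruct (Rle_dec 0 (-1)); [exfalso; lra | reflexivity].
  - exists 0. discriminate.
Qed.

Lemma half_line_integral_exp_opp : half_line_integral (fun t => exp (- t)) 1.
Proof.
  replace 1 with (0 - - exp (- 0)) by (rewrite Ropp_0, exp_0; ring).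
  apply half_line_integral_primitive with (G := fun t => - exp (- t)).
  - intros t. auto_derive; trivial. ring.
  - intros t. apply (ex_derive_continuous (V := R_NormedModule)). auto_derive; trivial.
  - replace (Finite 0) with (Rbar_opp 0) by (simpl; f_equal; ring).
    apply is_lim_opp, is_lim_exp_opp.
Qed.

(** The integral from [u] to [v] is at most [M * exp (- u)], so that the partial
    integrals are Cauchy. *)
Lemma half_line_integrable (g : R -> R) (M : R) :
  (forall t : R, continuous g t) ->
  (forall t : R, 0 <= t -> Rabs (g t) <= M * exp (- t)) ->
  exists l : R, half_line_integral g l.
Proof.
  intros Hg HM.
  assert (M0 : 0 <= M).
  { specialize (HM 0 (Rle_refl 0)). rewrite Ropp_0, exp_0 in HM.
    pose proof (Rabs_pos (g 0)). lra. }
  assert (Hex : forall a b, ex_RInt g a b).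
  { intros a b. apply (ex_RInt_continuous (V := R_CompleteNormedModule)). auto. }
  assert (Htail : forall u v, 0 <= u <= v -> Rabs (RInt g 0 v - RInt g 0 u) <= M * exp (- u)).
  { intros u v Huv.
    assert (HC : RInt g 0 v - RInt g 0 u = RInt g u v).
    { pose proof (RInt_Chasles (V := R_CompleteNormedModule) g 0 u v (Hex 0 u) (Hex u v)) as HC.
      unfold plus in HC; simpl in HC. lra. }
    rewrite HC.
    assert (Hb : is_RInt (fun t => M * exp (- t)) u v (- M * exp (- v) - - M * exp (- u))).
    { apply (is_RInt_derive (V := R_CompleteNormedModule) (fun t => - M * exp (- t))).
      - intros t _. auto_derive; trivial. ring.
      - intros t _. apply (ex_derive_continuous (V := R_NormedModule)). auto_derive; trivial. }
    apply Rle_trans with (- M * exp (- v) - - M * exp (- u)).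
    - apply (norm_RInt_le (V := R_NormedModule) g (fun t => M * exp (- t)) u v).
      + lra.
      + intros t Ht. apply HM. lra.
      + apply (RInt_correct (V := R_CompleteNormedModule)), Hex.
      + exact Hb.
    - pose proof (Rmult_le_pos _ _ M0 (Rlt_le _ _ (exp_pos (- v)))). lra. }
  destruct (proj1 (filterlim_locally_cauchy (U := R_CompleteSpace)
                     (F := Rbar_locally p_infty) (fun v => RInt g 0 v))) as [l Hl].
  - intros eps.
    assert (Hs : exists b, 0 < b /\ forall u, b < u -> M * exp (- u) < eps).
    { assert (Hlim : is_lim (fun u => M * exp (- u)) p_infty (Rbar_mult M 0)).
      { apply is_lim_scal_l, is_lim_exp_opp. }
      simpl in Hlim. rewrite Rmult_0_r in Hlim.
      apply is_lim_spec in Hlim. destruct (Hlim eps) as [b Hb].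
      exists (Rmax b 1). split. { pose proof (Rmax_r b 1). lra. }
      intros u Hu. pose proof (Rmax_l b 1).
      specialize (Hb u ltac:(lra)). apply Rabs_lt_between in Hb. lra. }
    destruct Hs as [b [Hb0 Hb]].
    exists (fun u => b < u). split. { exists b. tauto. }
    assert (Hball : forall u v, b < u -> u <= v -> Rabs (RInt g 0 v - RInt g 0 u) < eps).
    { intros u v Hu Huv. apply Rle_lt_trans with (M * exp (- u)); auto. apply Htail. lra. }
    intros u v Hu Hv. change (Rabs (RInt g 0 v - RInt g 0 u) < eps).
    destruct (Rle_dec u v).
    + apply Hball; trivial.
    + rewrite Rabs_minus_sym. apply Hball; lra.
  - exists l. apply half_line_integral_of_limit with (fun v => RInt g 0 v); trivial.
    intros b. apply (RInt_correct (V := R_CompleteNormedModule)), Hex.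
Qed.

Lemma is_RInt_gen_pair {Fa Fb : (R -> Prop) -> Prop} {FFa : Filter Fa} {FFb : Filter Fb}
    (g h : R -> R) (a b : R) :
  is_RInt_gen g Fa Fb a -> is_RInt_gen h Fa Fb b ->
  is_RInt_gen (V := C_R_NormedModule) (fun t => (g t, h t)) Fa Fb (a, b).
Proof.
  intros Hg Hh P [eps HP].
  assert (Ha := Hg (ball a eps) (locally_ball a eps)).
  assert (Hb := Hh (ball b eps) (locally_ball b eps)).
  unfold filtermapi in *.
  generalize (filter_and _ _ Ha Hb). apply filter_imp.
  intros ab [[ya [Ia Ba]] [yb [Ib Bb]]].
  exists (ya, yb). split.
  - apply (is_RInt_fct_extend_pair (U := R_NormedModule) (V := R_NormedModule)); trivial.
  - apply HP. split; trivial.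
Qed.

(** * The transform of [g] with kernel [exp (- x cosh t)] *)

(** Asking for a bound at every [x > 0], rather than a fixed growth rate of [g],
    makes the class stable under multiplication by [cosh]. *)
Definition moderate (g : R -> R) : Prop :=
  (forall t : R, continuous g t) /\
  (forall x : R, 0 < x -> exists M : R, forall t : R, 0 <= t ->
     exp (- x * cosh t) * Rabs (g t) <= M * exp (- t)).

Definition cosh_transform (g : R -> R) (x : R) : R :=
  RInt_gen (fun t => exp (- x * cosh t) * g t) (at_point 0) (Rbar_locally p_infty).

Lemma exp_mult_opp (t : R) : exp t * exp (- t) = 1.
Proof. rewrite <- exp_plus, Rplus_opp_r. apply exp_0. Qed.

Lemma one_le_cosh (t : R) : 1 <= cosh t.
Proof.
  unfold cosh. pose proof (exp_ineq1_le t). pose proof (exp_ineq1_le (- t)). lra.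
Qed.

Lemma half_exp_le_cosh (t : R) : exp t / 2 <= cosh t.
Proof. unfold cosh. pose proof (exp_pos (- t)). lra. Qed.

Lemma abs_sinh_le_cosh (t : R) : Rabs (sinh t) <= cosh t.
Proof.
  unfold sinh, cosh. pose proof (exp_pos t). pose proof (exp_pos (- t)).
  apply Rabs_le. lra.
Qed.

Lemma exp_opp_le_inv_sqr (s : R) : 0 < s -> exp (- s) <= 4 / (s * s).
Proof.
  intros Hs. pose proof (exp_ineq1_le (s / 2)) as H.
  rewrite exp_Ropp. replace s with (s / 2 + s / 2) at 1 by field.
  rewrite exp_plus.
  replace (4 / (s * s)) with (/ (s / 2 * (s / 2))) by (field; lra).
  apply Rinv_le_contravar; nra.
Qed.

Lemma kernel_le (x t : R) : 0 < x -> 0 <= t ->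
  exp (- x * cosh t) <= 16 / (x * x) * exp (- t).
Proof.
  intros Hx Ht. pose proof (half_exp_le_cosh t) as Hc. pose proof (exp_pos t) as He.
  assert (H1 : 1 <= exp t). { pose proof (exp_ineq1_le t). lra. }
  replace (- x * cosh t) with (- (x * cosh t)) by ring.
  assert (Hp : 0 < x * (exp t / 2)) by (apply Rmult_lt_0_compat; lra).
  assert (Hq : x * (exp t / 2) <= x * cosh t) by (apply Rmult_le_compat_l; lra).
  apply Rle_trans with (exp (- (x * (exp t / 2)))).
  { destruct (Req_dec (x * (exp t / 2)) (x * cosh t)) as [-> | Hne].
    - apply Rle_refl.
    - left. apply exp_increasing. lra. }
  eapply Rle_trans. { now apply exp_opp_le_inv_sqr. }
  replace (4 / (x * (exp t / 2) * (x * (exp t / 2))))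
    with (16 / (x * x) * (/ exp t * / exp t)) by (field; lra).
  rewrite exp_Ropp.
  apply Rmult_le_compat_l.
  - apply Rlt_le, Rdiv_lt_0_compat; nra.
  - assert (/ exp t <= 1). { rewrite <- Rinv_1. apply Rinv_le_contravar; lra. }
    pose proof (Rinv_0_lt_compat _ He). nra.
Qed.

Lemma moderate_bounded (g : R -> R) :
  (forall t : R, continuous g t) -> (forall t : R, Rabs (g t) <= 1) -> moderate g.
Proof.
  intros Hc Hg. split; trivial.
  intros x Hx. exists (16 / (x * x)). intros t Ht.
  apply Rle_trans with (exp (- x * cosh t) * 1).
  - apply Rmult_le_compat_l; [apply Rlt_le, exp_pos | apply Hg].
  - rewrite Rmult_1_r. now apply kernel_le.
Qed.

Lemma moderate_le (g h : R -> R) :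
  (forall t : R, continuous g t) -> (forall t : R, Rabs (g t) <= Rabs (h t)) ->
  moderate h -> moderate g.
Proof.
  intros Hc Hg [_ Hh]. split; trivial.
  intros x Hx. destruct (Hh x Hx) as [M HM]. exists M. intros t Ht.
  eapply Rle_trans; [| apply HM; trivial].
  apply Rmult_le_compat_l; [apply Rlt_le, exp_pos | apply Hg].
Qed.

Lemma continuous_cosh (t : R) : continuous cosh t.
Proof. apply (ex_derive_continuous (V := R_NormedModule)). auto_derive; trivial. Qed.

Lemma continuous_sinh (t : R) : continuous sinh t.
Proof. apply (ex_derive_continuous (V := R_NormedModule)). auto_derive; trivial. Qed.

Lemma continuous_Rmult (g h : R -> R) (t : R) :
  continuous g t -> continuous h t -> continuous (fun t => g t * h t) t.
Proof. intros Hg Hh. exact (continuous_mult (K := R_AbsRing) g h t Hg Hh). Qed.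

Lemma continuous_kernel (x t : R) : continuous (fun t => exp (- x * cosh t)) t.
Proof. apply (ex_derive_continuous (V := R_NormedModule)). auto_derive; trivial. Qed.

(** The kernel is the square of the kernel at [x / 2]; one factor absorbs [cosh t],
    the other bounds [g]. *)
Lemma moderate_cosh (g : R -> R) : moderate g -> moderate (fun t => cosh t * g t).
Proof.
  intros [Hc Hg]. split.
  { intros t. apply continuous_Rmult; auto using continuous_cosh. }
  intros x Hx. destruct (Hg (x / 2) ltac:(lra)) as [M HM].
  exists (2 / x * M). intros t Ht. specialize (HM t Ht).
  pose proof (one_le_cosh t) as H1.
  rewrite Rabs_mult, (Rabs_right (cosh t)) by lra.
  replace (- x * cosh t) with (- (x / 2) * cosh t + - (x / 2 * cosh t)) by field.
  rewrite exp_plus.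
  assert (Ha : cosh t * exp (- (x / 2 * cosh t)) <= 2 / x).
  { pose proof (exp_ineq1_le (x / 2 * cosh t)) as He. rewrite exp_Ropp.
    assert (Hp : 0 < x / 2 * cosh t) by nra.
    apply Rmult_le_reg_r with (exp (x / 2 * cosh t)). { apply exp_pos. }
    rewrite Rmult_assoc, Rinv_l by (apply Rgt_not_eq, exp_pos).
    apply Rmult_le_reg_l with (x / 2). { lra. }
    replace (x / 2 * (2 / x * exp (x / 2 * cosh t))) with (exp (x / 2 * cosh t))
      by (field; lra).
    lra. }
  assert (Hb : 0 <= exp (- (x / 2) * cosh t) * Rabs (g t)).
  { apply Rmult_le_pos; [apply Rlt_le, exp_pos | apply Rabs_pos]. }
  replace (exp (- (x / 2) * cosh t) * exp (- (x / 2 * cosh t)) * (cosh t * Rabs (g t)))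
    with (cosh t * exp (- (x / 2 * cosh t)) * (exp (- (x / 2) * cosh t) * Rabs (g t)))
    by ring.
  replace (2 / x * M * exp (- t)) with (2 / x * (M * exp (- t))) by ring.
  pose proof (Rlt_le _ _ (exp_pos (- (x / 2 * cosh t)))).
  apply Rmult_le_compat; trivial. nra.
Qed.

Lemma abs_kernel_mult (x t y : R) :
  Rabs (exp (- x * cosh t) * y) = exp (- x * cosh t) * Rabs y.
Proof. rewrite Rabs_mult, (Rabs_right (exp _)); [reflexivity | apply Rgt_ge, exp_pos]. Qed.

Lemma cosh_transform_correct (g : R -> R) (x : R) : moderate g -> 0 < x ->
  half_line_integral (fun t => exp (- x * cosh t) * g t) (cosh_transform g x).
Proof.
  intros [Hc Hg] Hx. destruct (Hg x Hx) as [M HM].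
  destruct (half_line_integrable (fun t => exp (- x * cosh t) * g t) M) as [l Hl].
  - intros t. apply continuous_Rmult; auto using continuous_kernel.
  - intros t Ht. rewrite abs_kernel_mult. auto.
  - unfold cosh_transform. now rewrite (half_line_integral_RInt_gen _ l Hl).
Qed.

(** Integration by parts in the form it takes here: the boundary term at
    infinity vanishes. *)
Lemma half_line_integral_kernel_primitive (G h : R -> R) (x : R) :
  moderate G -> 0 < x ->
  (forall t : R, is_derive (fun t => exp (- x * cosh t) * G t) t (h t)) ->
  (forall t : R, continuous h t) ->
  half_line_integral h (- (exp (- x) * G 0)).
Proof.
  intros [Hc HG] Hx Hd Hh. destruct (HG x Hx) as [M HM].
  replace (- (exp (- x) * G 0)) with (0 - exp (- x * cosh 0) * G 0)
    by (rewrite cosh_0, Rmult_1_r; ring).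
  apply (half_line_integral_primitive h (fun t => exp (- x * cosh t) * G t) 0); trivial.
  assert (Hlim : is_lim (fun t => M * exp (- t)) p_infty 0).
  { replace (Finite 0) with (Rbar_mult M 0) by (simpl; f_equal; ring).
    apply is_lim_scal_l, is_lim_exp_opp. }
  apply is_lim_le_le_loc with (fun t => - (M * exp (- t))) (fun t => M * exp (- t)).
  - exists 0. intros t Ht. apply Rabs_le_between.
    rewrite abs_kernel_mult. apply HM. lra.
  - replace (Finite 0) with (Rbar_opp 0) by (simpl; f_equal; ring).
    now apply is_lim_opp.
  - exact Hlim.
Qed.

Lemma exp_taylor1 (s : R) : Rabs (exp s - 1 - s) <= s * s * exp (Rabs s).
Proof.
  pose proof (exp_ineq1_le s) as H1. pose proof (exp_ineq1_le (- s)) as H2.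
  pose proof (exp_pos s) as Hp.
  pose proof (exp_mult_opp s) as He.
  (* [exp (- s) >= 1 - s] times [exp s] *)
  assert (H3 : exp s - 1 <= s * exp s) by nra.
  rewrite Rabs_right by lra.
  apply Rle_trans with (s * (exp s - 1)). { lra. }
  rewrite Rmult_assoc.
  destruct (Rle_dec 0 s) as [Hs | Hs].
  - rewrite (Rabs_right s) by lra. nra.
  - assert (1 <= exp (Rabs s)).
    { pose proof (exp_ineq1_le (Rabs s)). pose proof (Rabs_pos s). lra. }
    nra.
Qed.

(** The second-order remainder of the kernel in [x] is integrable uniformly for
    increments at most [x / 2], because it is dominated by the kernel at [x / 2]. *)
Lemma is_derive_cosh_transform (g : R -> R) (x : R) : moderate g -> 0 < x ->
  is_derive (cosh_transform g) x (- cosh_transform (fun t => cosh t * g t) x).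
Proof.
  intros Hg Hx. pose proof (moderate_cosh g Hg) as Hg1.
  pose proof (moderate_cosh _ Hg1) as Hg2.
  assert (Ha : moderate (fun t => Rabs (cosh t * (cosh t * g t)))).
  { apply moderate_le with (fun t => cosh t * (cosh t * g t)); trivial.
    - intros t. apply continuous_comp; [apply Hg2 | apply continuous_Rabs].
    - intros t. rewrite Rabs_Rabsolu. apply Rle_refl. }
  set (M := cosh_transform (fun t => Rabs (cosh t * (cosh t * g t))) (x / 2)).
  assert (HM : half_line_integral _ M) by (apply cosh_transform_correct; [trivial | lra]).
  assert (HR : forall h, Rabs h <= x / 2 ->
    Rabs (cosh_transform g (x + h) - cosh_transform g x
          + h * cosh_transform (fun t => cosh t * g t) x) <= h * h * M).
  { intros h Hh.
    assert (Hxh : 0 < x + h) by (apply Rabs_le_between in Hh; lra).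
    pose proof (cosh_transform_correct g (x + h) Hg Hxh) as I1.
    pose proof (cosh_transform_correct g x Hg Hx) as I2.
    pose proof (cosh_transform_correct _ x Hg1 Hx) as I3.
    pose proof (half_line_integral_plus _ _ _ _
      (half_line_integral_plus _ _ _ _ I1 (half_line_integral_scal (-1) _ _ I2))
      (half_line_integral_scal h _ _ I3)) as I.
    replace (cosh_transform g (x + h) - cosh_transform g x)
      with (cosh_transform g (x + h) + -1 * cosh_transform g x) by ring.
    refine (half_line_integral_bound _ _ _ _ _ I (half_line_integral_scal (h * h) _ _ HM)).
    intros t Ht. cbv beta.
    replace (- (x + h) * cosh t) with (- x * cosh t + - h * cosh t) by ring.
    rewrite exp_plus.
    replace (exp (- x * cosh t) * exp (- h * cosh t) * g t
             + -1 * (exp (- x * cosh t) * g t) + h * (exp (- x * cosh t) * (cosh t * g t)))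
      with (exp (- x * cosh t) * ((exp (- h * cosh t) - 1 - - h * cosh t) * g t)) by ring.
    rewrite abs_kernel_mult, Rabs_mult.
    pose proof (one_le_cosh t) as H1.
    pose proof (exp_taylor1 (- h * cosh t)) as HT.
    assert (HE : exp (- x * cosh t) * exp (Rabs (- h * cosh t)) <= exp (- (x / 2) * cosh t)).
    { rewrite <- exp_plus, Rabs_mult, Rabs_Ropp, (Rabs_right (cosh t)) by lra.
      destruct (Req_dec (Rabs h) (x / 2)) as [-> | Hne].
      - right. f_equal. field.
      - left. apply exp_increasing. nra. }
    rewrite !Rabs_mult, (Rabs_right (cosh t)) by lra.
    pose proof (Rabs_pos (g t)) as Hgp. pose proof (exp_pos (- x * cosh t)) as Hep.
    set (G := Rabs (g t)) in *.
    apply Rle_trans with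
      (exp (- x * cosh t) * (- h * cosh t * (- h * cosh t) * exp (Rabs (- h * cosh t)) * G)).
    { apply Rmult_le_compat_l; [lra |]. now apply Rmult_le_compat_r. }
    replace (exp (- x * cosh t) * (- h * cosh t * (- h * cosh t) * exp (Rabs (- h * cosh t)) * G))
      with (h * h * (exp (- x * cosh t) * exp (Rabs (- h * cosh t)) * (cosh t * (cosh t * G))))
      by ring.
    apply Rmult_le_compat_l; [nra |].
    apply Rmult_le_compat_r; [| exact HE].
    apply Rmult_le_pos; [lra | apply Rmult_le_pos; lra]. }
  assert (M0 : 0 <= M).
  { assert (Hh : Rabs (x / 2) <= x / 2) by (rewrite Rabs_right; lra).
    pose proof (HR _ Hh). pose proof (Rabs_pos (cosh_transform g (x + x / 2)
      - cosh_transform g x + x / 2 * cosh_transform (fun t => cosh t * g t) x)).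
    assert (0 < x / 2 * (x / 2)) by nra. nra. }
  apply is_derive_Reals. intros eps Heps.
  assert (Hd : 0 < Rmin (x / 2) (eps / (M + 1))).
  { apply Rmin_pos; [lra | apply Rdiv_lt_0_compat; lra]. }
  exists (mkposreal _ Hd). simpl. intros h Hh0 Hh.
  pose proof (Rmin_l (x / 2) (eps / (M + 1))). pose proof (Rmin_r (x / 2) (eps / (M + 1))).
  specialize (HR h ltac:(lra)).
  set (r := cosh_transform g (x + h) - cosh_transform g x
          + h * cosh_transform (fun t => cosh t * g t) x) in *.
  replace ((cosh_transform g (x + h) - cosh_transform g x) / h
           - - cosh_transform (fun t => cosh t * g t) x) with (r / h)
    by (unfold r; field; trivial).
  unfold Rdiv. rewrite Rabs_mult, Rabs_inv.
  pose proof (Rabs_pos_lt h Hh0) as Hp.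
  apply Rle_lt_trans with (Rabs h * M).
  - apply Rmult_le_reg_r with (Rabs h); trivial.
    rewrite Rmult_assoc, Rinv_l by lra.
    replace (Rabs h * M * Rabs h) with (Rabs h * Rabs h * M) by ring.
    rewrite <- Rabs_mult, (Rabs_right (h * h)) by nra. lra.
  - apply Rle_lt_trans with (Rabs h * (M + 1)). { nra. }
    apply Rlt_le_trans with (eps / (M + 1) * (M + 1)).
    + apply Rmult_lt_compat_r; lra.
    + right. field. lra.
Qed.

(** * The function [K_{i nu}] *)

Definition Kim (nu : R) : R -> R := cosh_transform (fun t => cos (nu * t)).

(** The derivative of [Kim nu], by differentiation under the integral sign. *)
Definition dKim (nu x : R) : R := - cosh_transform (fun t => cosh t * cos (nu * t)) x.

Lemma continuous_cos_mult (nu t : R) : continuous (fun t => cos (nu * t)) t.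
Proof. apply (ex_derive_continuous (V := R_NormedModule)). auto_derive; trivial. Qed.

Lemma continuous_sin_mult (nu t : R) : continuous (fun t => sin (nu * t)) t.
Proof. apply (ex_derive_continuous (V := R_NormedModule)). auto_derive; trivial. Qed.

Lemma moderate_cos (nu : R) : moderate (fun t => cos (nu * t)).
Proof.
  apply moderate_bounded; intros t.
  - apply continuous_cos_mult.
  - apply Rabs_le, COS_bound.
Qed.

Lemma moderate_sin (nu : R) : moderate (fun t => sin (nu * t)).
Proof.
  apply moderate_bounded; intros t.
  - apply continuous_sin_mult.
  - apply Rabs_le, SIN_bound.
Qed.

Lemma moderate_sinh_cos (nu : R) : moderate (fun t => sinh t * cos (nu * t)).
Proof.
  apply moderate_le with (fun t => cosh t * cos (nu * t)).
  - intros t. apply continuous_Rmult; auto using continuous_sinh, continuous_cos_mult.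
  - intros t. rewrite !Rabs_mult. apply Rmult_le_compat_r; [apply Rabs_pos |].
    rewrite (Rabs_right (cosh t)); [apply abs_sinh_le_cosh |].
    pose proof (one_le_cosh t). lra.
  - apply moderate_cosh, moderate_cos.
Qed.

Lemma is_derive_Kim (nu x : R) : 0 < x -> is_derive (Kim nu) x (dKim nu x).
Proof. intros Hx. now apply is_derive_cosh_transform; [apply moderate_cos |]. Qed.

Lemma cosh_sqr (t : R) : cosh t * cosh t = 1 + sinh t * sinh t.
Proof.
  unfold cosh, sinh.
  pose proof (exp_mult_opp t). nra.
Qed.

(** The modified Bessel equation in self-adjoint form: the integrand of
    [x^2 f'' + x f' - (x^2 - nu^2) f] is the derivative of
    [exp (- x cosh t) * (nu * sin (nu t) - x * sinh t * cos (nu t))]. *)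
Lemma bessel_equation (nu x : R) : 0 < x ->
  is_derive (fun x : R => x * dKim nu x) x ((x * x - nu * nu) / x * Kim nu x).
Proof.
  intros Hx.
  pose proof (moderate_cos nu) as M0.
  pose proof (moderate_cosh _ M0) as M1. pose proof (moderate_cosh _ M1) as M2.
  set (f2 := cosh_transform (fun t => cosh t * (cosh t * cos (nu * t))) x).
  assert (Hd : is_derive (dKim nu) x f2).
  { unfold dKim. replace f2 with (opp (- f2)) by (unfold opp; simpl; ring).
    apply (is_derive_opp (V := R_NormedModule)). now apply is_derive_cosh_transform. }
  assert (HI : half_line_integral
    (fun t => exp (- x * cosh t) *
       (x * x * (sinh t * sinh t) * cos (nu * t) - x * cosh t * cos (nu * t)
        + nu * nu * cos (nu * t)))
    (- (exp (- x) * (nu * sin (nu * 0) - x * (sinh 0 * cos (nu * 0)))))).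
  { apply half_line_integral_kernel_primitive
      with (G := fun t => nu * sin (nu * t) - x * (sinh t * cos (nu * t))); trivial.
    - split.
      + intros t. apply (ex_derive_continuous (V := R_NormedModule)). auto_derive; trivial.
      + intros y Hy. destruct (proj2 (moderate_sin nu) y Hy) as [A HA].
        destruct (proj2 (moderate_sinh_cos nu) y Hy) as [B HB].
        exists (Rabs nu * A + x * B). intros t Ht.
        specialize (HA t Ht). specialize (HB t Ht).
        assert (Hs : Rabs (nu * sin (nu * t) - x * (sinh t * cos (nu * t)))
          <= Rabs nu * Rabs (sin (nu * t)) + x * Rabs (sinh t * cos (nu * t))).
        { unfold Rminus. eapply Rle_trans; [apply Rabs_triang |].
          rewrite Rabs_Ropp, (Rabs_mult nu), (Rabs_mult x), (Rabs_right x) by lra. lra. }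
        apply (Rmult_le_compat_l (exp (- y * cosh t))) in Hs; [| apply Rlt_le, exp_pos].
        pose proof (Rabs_pos nu). nra.
    - intros t. auto_derive; trivial. ring.
    - intros t. apply (ex_derive_continuous (V := R_NormedModule)). auto_derive; trivial. }
  rewrite Rmult_0_r, sin_0, sinh_0 in HI.
  replace (- (exp (- x) * (nu * 0 - x * (0 * cos 0)))) with 0 in HI by ring.
  pose proof (cosh_transform_correct _ x M0 Hx) as I0.
  pose proof (cosh_transform_correct _ x M1 Hx) as I1.
  pose proof (cosh_transform_correct _ x M2 Hx) as I2.
  assert (E : 0 = x * x * f2 + (- x * cosh_transform (fun t => cosh t * cos (nu * t)) x
                  + (nu * nu - x * x) * Kim nu x)).
  { apply (half_line_integral_unique _ _ _ HI).
    eapply half_line_integral_ext; cycle 1.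
    { apply half_line_integral_plus; [| apply half_line_integral_plus];
        apply half_line_integral_scal; eassumption. }
    intros t _. cbv beta.
    replace (sinh t * sinh t) with (cosh t * cosh t - 1) by (rewrite cosh_sqr; ring).
    ring. }
  replace ((x * x - nu * nu) / x * Kim nu x) with (1 * dKim nu x + x * f2).
  - apply (is_derive_mult (K := R_AbsRing) (fun x => x) (dKim nu) x 1 f2); trivial.
    + apply (is_derive_id (K := R_AbsRing)).
    + intros a b. apply Rmult_comm.
  - unfold dKim. apply Rmult_eq_reg_l with x; [| lra].
    replace (x * ((x * x - nu * nu) / x * Kim nu x)) with ((x * x - nu * nu) * Kim nu x)
      by (field; lra).
    lra.
Qed.

Lemma abs_Kim_le (nu x : R) : 0 < x -> Rabs (Kim nu x) <= 16 / (x * x).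
Proof.
  intros Hx. rewrite <- (Rmult_1_r (16 / (x * x))).
  refine (half_line_integral_bound _ _ _ _ _
           (cosh_transform_correct _ x (moderate_cos nu) Hx)
           (half_line_integral_scal _ _ _ half_line_integral_exp_opp)).
  intros t Ht. rewrite abs_kernel_mult.
  apply Rle_trans with (exp (- x * cosh t) * 1).
  - apply Rmult_le_compat_l; [apply Rlt_le, exp_pos | apply Rabs_le, COS_bound].
  - rewrite Rmult_1_r. now apply kernel_le.
Qed.

Lemma one_sub_cos_le (y : R) : 1 - cos y <= y * y / 2.
Proof.
  replace y with (2 * (y / 2)) at 1 by field.
  rewrite cos_2a_sin.
  assert (Hs : sin (y / 2) * sin (y / 2) <= y / 2 * (y / 2)).
  { assert (H : forall z, 0 < z -> Rabs (sin z) <= z).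
    { intros z Hz. pose proof (sin_lt_x z Hz). apply Rabs_le. split; [| lra].
      destruct (Rle_dec z 1) as [H1 | H1].
      - assert (0 <= sin z). { apply sin_ge_0; pose proof PI2_1; lra. } lra.
      - pose proof (SIN_bound z). lra. }
    assert (H' : Rabs (sin (y / 2)) <= Rabs (y / 2)).
    { destruct (Rtotal_order (y / 2) 0) as [Hn | [-> | Hp]].
      - rewrite <- (Rabs_Ropp (sin _)), <- sin_neg, (Rabs_left (y / 2)) by lra.
        apply H. lra.
      - rewrite sin_0. apply Rle_refl.
      - rewrite (Rabs_right (y / 2)) by lra. now apply H. }
    apply Rsqr_le_abs_1 in H'. exact H'. }
  lra.
Qed.

(** Here [cosh t - 1] is half the square of [exp (t / 2) - exp (- t / 2)], which is
    at least [t / 2]. *)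
Lemma sqr_le_cosh (t : R) : 0 <= t -> t * t / 8 <= cosh t - 1.
Proof.
  intros Ht. unfold cosh.
  replace t with (t / 2 + t / 2) at 3 4 by field.
  rewrite Ropp_plus_distr, !exp_plus.
  pose proof (exp_ineq1_le (t / 2)) as H1.
  pose proof (exp_mult_opp (t / 2)) as H2.
  assert (H3 : exp (- (t / 2)) <= 1).
  { rewrite exp_Ropp, <- Rinv_1. apply Rinv_le_contravar; lra. }
  set (a := exp (t / 2)) in *. set (b := exp (- (t / 2))) in *.
  assert (t / 2 * (t / 2) <= (a - b) * (a - b)) by (apply Rmult_le_compat; lra).
  nra.
Qed.

(** As [x] grows the kernel concentrates at [t = 0], where the cosine is near
    [1].  Both bounds on the mass [J] of the kernel come from primitives:
    [- tanh t] compares the integral of [cosh t - 1] with [J / x], and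
    [- 1 / cosh t] bounds [J] away from [0]. *)
Lemma Kim_pos (nu x : R) : 0 < x -> 4 * (nu * nu) < x -> 0 < Kim nu x.
Proof.
  intros Hx Hnu.
  assert (M1 : moderate (fun _ => 1)).
  { apply moderate_bounded; intros t. { apply continuous_const. }
    rewrite Rabs_R1. apply Rle_refl. }
  pose proof (cosh_transform_correct _ x M1 Hx) as IJ.
  set (J := cosh_transform (fun _ => 1) x) in *.
  pose proof (cosh_transform_correct _ x (moderate_cos nu) Hx) as IK.
  assert (HJ : exp (- x) <= (1 + x) * J).
  { assert (H : half_line_integral
      (fun t => exp (- x * cosh t) * (sinh t / (cosh t * cosh t) + x * (sinh t / cosh t)))
      (- (exp (- x) * (- / cosh 0)))).
    { apply half_line_integral_kernel_primitive with (G := fun t => - / cosh t); trivial.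
      - apply moderate_bounded; intros t; pose proof (one_le_cosh t).
        + apply (ex_derive_continuous (V := R_NormedModule)). auto_derive. lra.
        + rewrite Rabs_Ropp, Rabs_inv, Rabs_right by lra.
          rewrite <- Rinv_1. apply Rinv_le_contravar; lra.
      - intros t. pose proof (one_le_cosh t). auto_derive; [lra |]. field. lra.
      - intros t. pose proof (one_le_cosh t).
        apply (ex_derive_continuous (V := R_NormedModule)). auto_derive.
        repeat split; nra. }
    rewrite cosh_0, Rinv_1 in H.
    replace (- (exp (- x) * - (1))) with (exp (- x)) in H by ring.
    refine (half_line_integral_le _ _ _ _ _ H (half_line_integral_scal _ _ _ IJ)).
    intros t Ht. cbv beta. pose proof (one_le_cosh t) as H1.
    pose proof (abs_sinh_le_cosh t) as H2. apply Rabs_le_between in H2.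
    rewrite Rmult_1_r, (Rmult_comm (1 + x)).
    apply Rmult_le_compat_l; [apply Rlt_le, exp_pos |].
    assert (Hq : sinh t / cosh t <= 1).
    { apply Rmult_le_reg_r with (cosh t); [lra |].
      unfold Rdiv. rewrite Rmult_assoc, Rinv_l by lra. lra. }
    assert (Hr : sinh t / (cosh t * cosh t) <= 1).
    { apply Rmult_le_reg_r with (cosh t * cosh t); [nra |].
      unfold Rdiv. rewrite Rmult_assoc, Rinv_l by nra. nra. }
    nra. }
  assert (Htanh : half_line_integral
    (fun t => exp (- x * cosh t) *
       (x * (sinh t * sinh t / cosh t) - / (cosh t * cosh t)))
    (- (exp (- x) * (- (sinh 0 / cosh 0))))).
  { apply half_line_integral_kernel_primitive with (G := fun t => - (sinh t / cosh t)); trivial.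
    - apply moderate_bounded; intros t; pose proof (one_le_cosh t).
      + apply (ex_derive_continuous (V := R_NormedModule)). auto_derive. lra.
      + rewrite Rabs_Ropp. unfold Rdiv.
        rewrite Rabs_mult, Rabs_inv, (Rabs_right (cosh t)) by lra.
        apply Rmult_le_reg_r with (cosh t); [lra |].
        rewrite Rmult_assoc, Rinv_l by lra. pose proof (abs_sinh_le_cosh t). lra.
    - intros t. pose proof (one_le_cosh t). auto_derive; [lra |].
      replace (x * (sinh t * sinh t / cosh t) - / (cosh t * cosh t))
        with (x * (sinh t * sinh t / cosh t)
              - (cosh t * cosh t - sinh t * sinh t) * / (cosh t * cosh t))
        by (rewrite cosh_sqr at 1; ring).
      field. lra.
    - intros t. pose proof (one_le_cosh t).
      apply (ex_derive_continuous (V := R_NormedModule)). auto_derive.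
      repeat split; nra. }
  rewrite sinh_0 in Htanh.
  replace (- (exp (- x) * (- (0 / cosh 0)))) with 0 in Htanh
    by (rewrite cosh_0; field).
  assert (HK : x * J + - (4 * (nu * nu)) * (0 + J) <= x * Kim nu x).
  { refine (half_line_integral_le _ _ _ _ _
      (half_line_integral_plus _ _ _ _ (half_line_integral_scal x _ _ IJ)
        (half_line_integral_scal (- (4 * (nu * nu))) _ _
          (half_line_integral_plus _ _ _ _ Htanh IJ)))
      (half_line_integral_scal x _ _ IK)).
    intros t Ht. cbv beta.
    pose proof (one_le_cosh t) as H1.
    pose proof (one_sub_cos_le (nu * t)) as H2. pose proof (sqr_le_cosh t Ht) as H3.
    pose proof (exp_pos (- x * cosh t)) as He. set (e := exp (- x * cosh t)) in *.
    assert (HN : 0 <= 4 * (nu * nu)) by nra.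
    pose proof (Rmult_le_compat_l _ _ _ HN H3) as H4.
    assert (H5 : cosh t - 1 <= sinh t * sinh t / cosh t).
    { replace (sinh t * sinh t) with (cosh t * cosh t - 1) by (rewrite cosh_sqr; ring).
      apply Rmult_le_reg_r with (cosh t); [lra |].
      unfold Rdiv. rewrite Rmult_assoc, Rinv_l by lra. nra. }
    assert (H6 : / (cosh t * cosh t) <= 1).
    { rewrite <- Rinv_1. apply Rinv_le_contravar; nra. }
    set (s := sinh t * sinh t / cosh t) in *. set (r := / (cosh t * cosh t)) in *.
    assert (H7 : x * (cosh t - 1) <= x * s - r + 1)
      by (apply (Rmult_le_compat_l x) in H5; lra).
    assert (H8 : x - 4 * (nu * nu) * (x * s - r + 1) <= x * cos (nu * t)).
    { pose proof (Rmult_le_compat_l _ _ _ HN H7) as H9.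
      assert (H10 : 1 - 4 * (nu * nu) * (cosh t - 1) <= cos (nu * t)) by lra.
      apply (Rmult_le_compat_l x) in H10; lra. }
    apply (Rmult_le_compat_l e) in H8; lra. }
  assert (J0 : 0 < J).
  { pose proof (exp_pos (- x)). apply Rmult_lt_reg_l with (1 + x); lra. }
  assert (Hp : 0 < (x - 4 * (nu * nu)) * J) by (apply Rmult_lt_0_compat; lra).
  apply Rmult_lt_reg_l with x; lra.
Qed.

Lemma Ccosh_pair (a b : R) : Ccosh (a, b) = (cosh a * cos b, sinh a * sin b).
Proof.
  unfold Ccosh, Cexp, cosh, sinh.
  apply injective_projections; simpl; rewrite cos_neg, sin_neg; field.
Qed.

Lemma BesselK_pair (a nu x u v : R) :
  half_line_integral (fun t => exp (- x * cosh t) * (cosh (a * t) * cos (nu * t))) u ->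
  half_line_integral (fun t => exp (- x * cosh t) * (sinh (a * t) * sin (nu * t))) v ->
  BesselK (a, nu) x = (u, v).
Proof.
  intros Hu Hv. pose proof (is_RInt_gen_pair _ _ _ _ Hu Hv) as H.
  refine (is_RInt_gen_unique (V := C_R_CompleteNormedModule) (Fa := at_point 0)
            (Fb := Rbar_locally p_infty) _ _ _).
  revert H. apply (is_RInt_gen_ext (V := C_R_NormedModule)).
  apply (eventually_above 0). intros w _ t _.
  replace ((a, nu) * RtoC t)%C with ((a * t, nu * t) : C)
    by (apply injective_projections; simpl; ring).
  rewrite Ccosh_pair. apply injective_projections; simpl; ring.
Qed.

Lemma BesselK_imaginary (nu x : R) : 0 < x -> BesselK (Ci * RtoC nu)%C x = RtoC (Kim nu x).
Proof.
  intros Hx.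
  replace (Ci * RtoC nu)%C with ((0, nu) : C) by (apply injective_projections; simpl; ring).
  apply BesselK_pair.
  - eapply half_line_integral_ext, cosh_transform_correct, Hx; [| apply moderate_cos].
    intros t _. cbv beta. rewrite Rmult_0_l, cosh_0. ring.
  - rewrite <- (Rmult_0_l (cosh_transform (fun t => cos (nu * t)) x)).
    eapply half_line_integral_ext, half_line_integral_scal, cosh_transform_correct, Hx;
      [| apply moderate_cos].
    intros t _. cbv beta. rewrite !Rmult_0_l, sinh_0. ring.
Qed.

(** The derivative of [exp (- x cosh t) * sin (nu t)] trades [x sinh t sin (nu t)]
    for [nu cos (nu t)]. *)
Lemma sinh_sin_integral (nu x : R) : 0 < x ->
  half_line_integral (fun t => exp (- x * cosh t) * (sinh t * sin (nu * t)))
    (nu / x * Kim nu x).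
Proof.
  intros Hx.
  assert (H : half_line_integral
    (fun t => exp (- x * cosh t) * (nu * cos (nu * t) - x * (sinh t * sin (nu * t))))
    (- (exp (- x) * sin (nu * 0)))).
  { apply half_line_integral_kernel_primitive with (G := fun t => sin (nu * t)); trivial.
    - apply moderate_sin.
    - intros t. auto_derive; trivial. ring.
    - intros t. apply (ex_derive_continuous (V := R_NormedModule)). auto_derive; trivial. }
  rewrite Rmult_0_r, sin_0, Rmult_0_r, Ropp_0 in H.
  pose proof (cosh_transform_correct _ x (moderate_cos nu) Hx) as I.
  replace (nu / x * Kim nu x) with (- / x * 0 + nu / x * Kim nu x) by ring.
  eapply half_line_integral_ext; cycle 1.
  { apply half_line_integral_plus; apply half_line_integral_scal; eassumption. }
  intros t _. cbv beta. field. lra.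
Qed.

(** The complex form of [K_{mu + 1} = - K_mu' + (mu / x) K_mu] at [mu = i nu]. *)
Lemma BesselK_imaginary_add1 (nu x : R) : 0 < x ->
  BesselK (Ci * RtoC nu + 1)%C x = (- dKim nu x, nu / x * Kim nu x).
Proof.
  intros Hx. unfold dKim. rewrite Ropp_involutive.
  replace (Ci * RtoC nu + 1)%C with ((1, nu) : C)
    by (apply injective_projections; simpl; ring).
  apply BesselK_pair.
  - eapply half_line_integral_ext, cosh_transform_correct, Hx;
      [| apply moderate_cosh, moderate_cos].
    intros t _. cbv beta. now rewrite Rmult_1_l.
  - eapply half_line_integral_ext, sinh_sin_integral, Hx.
    intros t _. cbv beta. now rewrite Rmult_1_l.
Qed.

Lemma BesselK_imaginary_sub1 (nu x : R) : 0 < x ->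
  BesselK (Ci * RtoC nu - 1)%C x = (- dKim nu x, - (nu / x * Kim nu x)).
Proof.
  intros Hx. unfold dKim. rewrite Ropp_involutive.
  replace (Ci * RtoC nu - 1)%C with ((-1, nu) : C)
    by (apply injective_projections; simpl; ring).
  apply BesselK_pair.
  - eapply half_line_integral_ext, cosh_transform_correct, Hx;
      [| apply moderate_cosh, moderate_cos].
    intros t _. cbv beta. replace (-1 * t) with (- t) by ring.
    unfold cosh. rewrite Ropp_involutive. field.
  - replace (- (nu / x * Kim nu x)) with (-1 * (nu / x * Kim nu x)) by ring.
    eapply half_line_integral_ext, half_line_integral_scal, sinh_sin_integral, Hx.
    intros t _. cbv beta. replace (-1 * t) with (- t) by ring.
    unfold sinh. rewrite Ropp_involutive. field.
Qed.

(** * The scaled determinant and the simplicity of zeros *)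

(** This is [x^2 (K_{i nu - 1} K_{i nu + 1} - K_{i nu}^2)]. *)
Definition scaled_turan (nu x : R) : R :=
  x * dKim nu x * (x * dKim nu x) + (nu * nu - x * x) * (Kim nu x * Kim nu x).

Lemma is_derive_ex_Derive (f : R -> R) (x l : R) :
  is_derive f x l -> ex_derive f x /\ Derive f x = l.
Proof. intros H. split; [now exists l | now apply is_derive_unique]. Qed.

Lemma is_derive_scaled_turan (nu x : R) : 0 < x ->
  is_derive (scaled_turan nu) x (- (2 * x * (Kim nu x * Kim nu x))).
Proof.
  intros Hx. unfold scaled_turan.
  destruct (is_derive_ex_Derive _ _ _ (is_derive_Kim nu x Hx)) as [E0 D0].
  pose proof (bessel_equation nu x Hx) as Hp.
  remember (fun x : R => x * dKim nu x) as p eqn:Ep in Hp.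
  destruct (is_derive_ex_Derive _ _ _ Hp) as [E1 D1].
  apply (is_derive_ext (fun x => p x * p x + (nu * nu - x * x) * (Kim nu x * Kim nu x))).
  { intros y. now rewrite Ep. }
  auto_derive; [repeat split; assumption |].
  (* [Derive] appears under an eta-expansion *)
  replace (Derive (fun x0 => p x0) x) with (Derive p x) by reflexivity.
  replace (Derive (fun x0 => Kim nu x0) x) with (Derive (Kim nu) x) by reflexivity.
  rewrite D0, D1, Ep. field. lra.
Qed.

Lemma is_derive_continuity (f : R -> R) (x l : R) : is_derive f x l -> continuity_pt f x.
Proof.
  intros H. apply derivable_continuous_pt. exists l. now apply is_derive_Reals.
Qed.

Lemma scaled_turan_antitone (nu x y : R) : 0 < x -> x <= y ->
  scaled_turan nu y <= scaled_turan nu x.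
Proof.
  intros Hx Hxy.
  destruct (MVT_gen (scaled_turan nu) x y (fun t => - (2 * t * (Kim nu t * Kim nu t))))
    as [c [Hc E]].
  - rewrite Rmin_left, Rmax_right by lra. intros t Ht. apply is_derive_scaled_turan. lra.
  - rewrite Rmin_left, Rmax_right by lra. intros t Ht.
    eapply is_derive_continuity, is_derive_scaled_turan. lra.
  - rewrite Rmin_left, Rmax_right in Hc by lra.
    assert (0 <= 2 * c * (Kim nu c * Kim nu c)) by (apply Rmult_le_pos; nra).
    nra.
Qed.

(** A function that decreases and is bounded below by [- x^2 K^2], which tends
    to [0], is nonnegative; if it vanished at [x] it would vanish from [x] on,
    and so would its derivative [- 2 x K^2], whereas [K] is positive far out. *)
Lemma scaled_turan_pos (nu x : R) : 0 < x -> 0 < scaled_turan nu x.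
Proof.
  intros Hx.
  assert (Hnonneg : forall y, 0 < y -> 0 <= scaled_turan nu y).
  { intros y Hy. apply Rnot_lt_le. intros Hneg.
    set (d := - scaled_turan nu y). assert (Hd : 0 < d) by (unfold d; lra).
    (* at [z] the lower bound [- 256 / z^2] exceeds [- d] *)
    set (z := y + 256 / d + 1).
    assert (Hq : 0 < 256 / d) by (apply Rdiv_lt_0_compat; lra).
    assert (Hz : 0 < z) by (unfold z; lra).
    pose proof (scaled_turan_antitone nu y z Hy ltac:(unfold z; lra)) as H1.
    pose proof (abs_Kim_le nu z Hz) as HK.
    assert (H2 : z * Rabs (Kim nu z) <= 16 / z).
    { apply Rle_trans with (z * (16 / (z * z))).
      - apply Rmult_le_compat_l; lra.
      - right. field. lra. }
    assert (H3 : z * z * (Kim nu z * Kim nu z) <= 256 / (z * z)).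
    { replace (z * z * (Kim nu z * Kim nu z))
        with (z * Rabs (Kim nu z) * (z * Rabs (Kim nu z))).
      - replace (256 / (z * z)) with (16 / z * (16 / z)) by (field; lra).
        assert (0 <= z * Rabs (Kim nu z)).
        { apply Rmult_le_pos; [lra | apply Rabs_pos]. }
        apply Rmult_le_compat; lra.
      - replace (z * Rabs (Kim nu z) * (z * Rabs (Kim nu z)))
          with (z * z * (Rabs (Kim nu z) * Rabs (Kim nu z))) by ring.
        rewrite <- Rabs_mult, (Rabs_right (Kim nu z * Kim nu z)) by nra. ring. }
    assert (H4 : 256 / (z * z) < d).
    { apply Rmult_lt_reg_r with (z * z); [nra |].
      replace (256 / (z * z) * (z * z)) with 256 by (field; lra).
      assert (256 < d * z).
      { unfold z. replace (d * (y + 256 / d + 1)) with (256 + d * y + d) by (field; lra).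
        nra. }
      assert (1 <= z) by (unfold z; lra). nra. }
    unfold scaled_turan in H1 at 1.
    pose proof (Rle_0_sqr (z * dKim nu z)) as S1. unfold Rsqr in S1.
    pose proof (Rle_0_sqr (nu * Kim nu z)) as S2. unfold Rsqr in S2.
    unfold d in H4. nra. }
  destruct (Hnonneg x Hx) as [H | H]; trivial. exfalso.
  set (y := Rmax x (4 * (nu * nu)) + 1).
  pose proof (Rmax_l x (4 * (nu * nu))). pose proof (Rmax_r x (4 * (nu * nu))).
  assert (Hy : x < y) by (unfold y; lra).
  pose proof (Kim_pos nu y ltac:(lra) ltac:(unfold y; lra)) as Hp.
  assert (Hder : is_derive (scaled_turan nu) y 0).
  { apply (is_derive_ext_loc (fun _ => 0)).
    - exists (mkposreal (y - x) ltac:(lra)). intros z Hz.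
      change (Rabs (z - y) < y - x) in Hz. apply Rabs_lt_between in Hz.
      pose proof (Hnonneg z ltac:(lra)).
      pose proof (scaled_turan_antitone nu x z Hx ltac:(lra)). lra.
    - exact (is_derive_const (K := R_AbsRing) (V := R_NormedModule) 0 y). }
  apply is_derive_unique in Hder.
  rewrite (is_derive_unique _ _ _ (is_derive_scaled_turan nu y ltac:(lra))) in Hder.
  assert (0 < 2 * y * (Kim nu y * Kim nu y)).
  { apply Rmult_lt_0_compat; [lra | nra]. }
  lra.
Qed.

(** At a double zero the scaled determinant would vanish. *)
Lemma dKim_neq_0 (nu x : R) : 0 < x -> Kim nu x = 0 -> dKim nu x <> 0.
Proof.
  intros Hx H0 H1. pose proof (scaled_turan_pos nu x Hx) as HD.
  unfold scaled_turan in HD. rewrite H0, H1 in HD. lra.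
Qed.

Lemma is_derive_sign_near (f : R -> R) (a l : R) : is_derive f a l -> f a = 0 -> l <> 0 ->
  exists d : R, 0 < d /\ forall x : R, x <> a -> Rabs (x - a) < d -> 0 < l * (f x * (x - a)).
Proof.
  intros H H0 Hl. apply is_derive_Reals in H.
  destruct (H (Rabs l) (Rabs_pos_lt _ Hl)) as [d Hd].
  exists d. split. { apply cond_pos. }
  intros x Hx Hxd. specialize (Hd (x - a) ltac:(lra) Hxd).
  replace (a + (x - a)) with x in Hd by ring. rewrite H0, Rminus_0_r in Hd.
  set (q := f x / (x - a)) in *.
  replace (f x) with (q * (x - a)) by (unfold q; field; lra).
  assert (Hlq : 0 < l * q).
  { unfold Rabs in Hd. destruct (Rcase_abs (q - l)), (Rcase_abs l); nra. }
  assert (0 < (x - a) * (x - a)) by nra. nra.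
Qed.

Lemma continuity_pt_nonzero_near (f : R -> R) (a : R) : continuity_pt f a -> f a <> 0 ->
  exists d : R, 0 < d /\ forall x : R, Rabs (x - a) < d -> f x <> 0.
Proof.
  intros H Hne. apply continuity_pt_locally with (eps := mkposreal _ (Rabs_pos_lt _ Hne)) in H.
  destruct H as [d Hd]. exists d. split. { apply cond_pos. }
  intros x Hx E. specialize (Hd x Hx). simpl in Hd.
  rewrite E, Rabs_minus_sym, Rminus_0_r in Hd. lra.
Qed.

Lemma Kim_continuity (nu x : R) : 0 < x -> continuity_pt (Kim nu) x.
Proof. intros Hx. eapply is_derive_continuity, is_derive_Kim, Hx. Qed.

Lemma zeros_isolated (nu a : R) : 0 < a ->
  exists d : R, 0 < d /\ forall x : R, x <> a -> Rabs (x - a) < d -> Kim nu x <> 0.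
Proof.
  intros Ha. destruct (Req_dec (Kim nu a) 0) as [H0 | Hne].
  - destruct (is_derive_sign_near _ a _ (is_derive_Kim nu a Ha) H0 (dKim_neq_0 nu a Ha H0))
      as [d [Hd H]].
    exists d. split; trivial. intros x Hx Hxd E. specialize (H x Hx Hxd).
    rewrite E in H. lra.
  - destruct (continuity_pt_nonzero_near _ a (Kim_continuity nu a Ha) Hne) as [d [Hd H]].
    exists d. split; trivial. auto.
Qed.

Lemma ivt_of_opposite_signs (f : R -> R) (a b : R) : a < b ->
  (forall x : R, a <= x <= b -> continuity_pt f x) -> f a * f b < 0 ->
  exists c : R, a < c < b /\ f c = 0.
Proof.
  intros Hab Hc Hs.
  assert (H : exists c, a <= c <= b /\ f c = 0).
  { destruct (Rtotal_order (f a) 0) as [Hn | [E | Hp]].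
    - destruct (Ranalysis5.IVT_interv f a b Hc Hab Hn) as [c Hf]; [nra | now exists c].
    - rewrite E in Hs. lra.
    - destruct (Ranalysis5.IVT_interv (fun x => - f x) a b) as [c [Hf E]]; trivial; try nra.
      + intros x Hx. apply continuity_pt_opp. auto.
      + exists c. split; trivial. lra. }
  destruct H as [c [Hcab E]]. exists c. split; trivial.
  assert (c <> a) by (intros ->; rewrite E in Hs; lra).
  assert (c <> b) by (intros ->; rewrite E in Hs; lra).
  lra.
Qed.

Lemma Kim_same_sign (nu a b x y : R) : 0 < a ->
  (forall t : R, a < t < b -> Kim nu t <> 0) -> a < x < b -> a < y < b ->
  0 < Kim nu x * Kim nu y.
Proof.
  intros Ha Hne Hx Hy.
  assert (Hlt : forall u v, a < u -> u < v -> v < b -> 0 < Kim nu u * Kim nu v).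
  { intros u v Hu Huv Hv. apply Rnot_le_lt. intros [Hle | E].
    - destruct (ivt_of_opposite_signs (Kim nu) u v Huv) as [c [Hc E]]; trivial.
      + intros t Ht. apply Kim_continuity. lra.
      + apply (Hne c); trivial. lra.
    - apply Rmult_integral in E. destruct E as [E | E].
      + apply (Hne u); trivial. lra.
      + apply (Hne v); trivial. lra. }
  destruct (Rtotal_order x y) as [H | [<- | H]].
  - apply Hlt; lra.
  - pose proof (Hne x Hx). nra.
  - rewrite Rmult_comm. apply Hlt; lra.
Qed.

(** * Oscillation near [0] *)

(** Sturm comparison: in the variable [s = ln x] the equation reads
    [g'' = (x^2 - nu^2) g], so for [x < nu / 2] it oscillates faster than
    [sin (m s)] with [m = nu / 2].  If [K_{i nu}] kept its sign on a half period
    [th] from [0] to [PI], the Wronskian [W] with [sin th] would both decrease and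
    have a positive increment. *)
Lemma arbitrarily_small_zeros (nu e : R) : 0 < nu -> 0 < e ->
  exists x : R, 0 < x < e /\ Kim nu x = 0.
Proof.
  intros Hnu He. apply NNPP. intros Hno.
  assert (Hne : forall t, 0 < t < e -> Kim nu t <> 0).
  { intros t Ht E. apply Hno. now exists t. }
  set (m := nu / 2). set (b := Rmin e (nu / 2) / 2).
  pose proof (Rmin_l e (nu / 2)). pose proof (Rmin_r e (nu / 2)).
  assert (Hm : 0 < m) by (unfold m; lra).
  assert (0 < Rmin e (nu / 2)) by (apply Rmin_pos; lra).
  assert (Hb : 0 < b < e) by (unfold b; lra).
  assert (Hbn : b < nu / 2) by (unfold b; lra).
  pose proof PI_RGT_0 as HPI.
  assert (Hpm : 0 < PI / m) by (apply Rdiv_lt_0_compat; lra).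
  set (a := b * exp (- (PI / m))).
  assert (Ha : 0 < a) by (apply Rmult_lt_0_compat; [lra | apply exp_pos]).
  assert (Hab : a < b).
  { assert (exp (- (PI / m)) < 1). { rewrite <- exp_0. apply exp_increasing. lra. }
    unfold a. nra. }
  assert (Hln : ln a = ln b - PI / m).
  { unfold a. rewrite ln_mult, ln_exp; [ring | lra | apply exp_pos]. }
  set (th := fun x => m * (ln x - ln a)).
  assert (Tha : th a = 0) by (unfold th; ring).
  assert (Thb : th b = PI) by (unfold th; rewrite Hln; field; lra).
  assert (Hth : forall x, a <= x <= b -> 0 <= th x <= PI).
  { intros x Hx. rewrite <- Thb. unfold th.
    assert (ln a <= ln x) by (apply ln_le; lra).
    assert (ln x <= ln b) by (apply ln_le; lra). nra. }
  set (W := fun x => Kim nu a * (x * dKim nu x * sin (th x) - m * Kim nu x * cos (th x))).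
  set (dW := fun x => Kim nu a * ((x * x - nu * nu + m * m) / x * Kim nu x * sin (th x))).
  assert (HW : forall x, 0 < x -> is_derive W x (dW x)).
  { intros x Hx. unfold W, dW.
    destruct (is_derive_ex_Derive _ _ _ (is_derive_Kim nu x Hx)) as [E0 D0].
    pose proof (bessel_equation nu x Hx) as Hp.
    remember (fun x : R => x * dKim nu x) as p eqn:Ep in Hp.
    destruct (is_derive_ex_Derive _ _ _ Hp) as [E1 D1].
    apply (is_derive_ext (fun x => Kim nu a *
      (p x * sin (m * (ln x - ln a)) - m * Kim nu x * cos (m * (ln x - ln a))))).
    { intros y. now rewrite Ep. }
    auto_derive; [repeat split; assumption |].
    replace (Derive (fun x0 => p x0) x) with (Derive p x) by reflexivity.
    replace (Derive (fun x0 => Kim nu x0) x) with (Derive (Kim nu) x) by reflexivity.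
    rewrite D0, D1, Ep. unfold th, Rminus. field. lra. }
  destruct (MVT_gen W a b dW) as [c [Hc E]].
  - rewrite Rmin_left, Rmax_right by lra. intros x Hx. apply HW. lra.
  - rewrite Rmin_left, Rmax_right by lra. intros x Hx.
    eapply is_derive_continuity, HW. lra.
  - rewrite Rmin_left, Rmax_right in Hc by lra.
    unfold W, dW in E. rewrite Tha, Thb, sin_0, cos_0, sin_PI, cos_PI in E.
    assert (Hsig : forall x, a <= x <= b -> 0 < Kim nu a * Kim nu x).
    { intros x Hx. apply (Kim_same_sign nu (a / 2) e); try lra.
      intros t Ht. apply Hne. lra. }
    pose proof (Hsig a ltac:(lra)) as Sa. pose proof (Hsig b ltac:(lra)) as Sb.
    pose proof (Hsig c Hc) as Sc.
    pose proof (sin_ge_0 _ (proj1 (Hth c Hc)) (proj2 (Hth c Hc))) as Hsin.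
    assert (Hq : (c * c - nu * nu + m * m) / c <= 0).
    { apply Rmult_le_reg_r with c; [lra |].
      unfold Rdiv. rewrite Rmult_assoc, Rinv_l by lra. unfold m. nra. }
    set (q := (c * c - nu * nu + m * m) / c) in *.
    assert (B1 : 0 <= Kim nu a * Kim nu c * sin (th c) * (b - a)).
    { apply Rmult_le_pos; [apply Rmult_le_pos |]; lra. }
    assert (B2 : 0 <= - q * (Kim nu a * Kim nu c * sin (th c) * (b - a))).
    { apply Rmult_le_pos; lra. }
    assert (B3 : 0 < m * (Kim nu a * Kim nu a + Kim nu a * Kim nu b)).
    { apply Rmult_lt_0_compat; lra. }
    lra.
Qed.

(** * The quotient [T_nu] between consecutive zeros *)

Lemma TnuE (nu x : R) : 0 < x -> Kim nu x <> 0 ->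
  Tnu nu x = scaled_turan nu x / (x * x * (Kim nu x * Kim nu x)).
Proof.
  intros Hx Hne. unfold Tnu.
  rewrite BesselK_imaginary, BesselK_imaginary_add1, BesselK_imaginary_sub1 by trivial.
  unfold scaled_turan. simpl. field. split; trivial. lra.
Qed.

Lemma Tnu_pos (nu x : R) : 0 < x -> Kim nu x <> 0 -> 0 < Tnu nu x.
Proof.
  intros Hx Hne. rewrite TnuE by trivial.
  apply Rdiv_lt_0_compat; [now apply scaled_turan_pos |].
  apply Rmult_lt_0_compat; nra.
Qed.

(** Up to a negative factor this is [T_nu'], and it is
    [D * (1 + x f' / f + 1 / T)] where [f] is [K_{i nu}], [T] is [T_nu] and [D]
    is [x^2 f^2 T]. *)
Definition slope_factor (nu x : R) : R :=
  scaled_turan nu x * (1 + x * dKim nu x / Kim nu x) + x * x * (Kim nu x * Kim nu x).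

Lemma is_derive_Tnu (nu x : R) : 0 < x -> Kim nu x <> 0 ->
  is_derive (Tnu nu) x (- (2 * slope_factor nu x / (x * x * x * (Kim nu x * Kim nu x)))).
Proof.
  intros Hx Hne.
  apply (is_derive_ext_loc (fun y => scaled_turan nu y / (y * y * (Kim nu y * Kim nu y)))).
  { destruct (continuity_pt_nonzero_near _ x (Kim_continuity nu x Hx) Hne) as [d [Hd H]].
    exists (mkposreal _ (Rmin_pos _ _ Hd Hx)). intros y Hy.
    change (Rabs (y - x) < Rmin d x) in Hy.
    pose proof (Rmin_l d x). pose proof (Rmin_r d x).
    symmetry. apply TnuE.
    - apply Rabs_lt_between in Hy. lra.
    - apply H. lra. }
  destruct (is_derive_ex_Derive _ _ _ (is_derive_Kim nu x Hx)) as [E0 D0].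
  destruct (is_derive_ex_Derive _ _ _ (is_derive_scaled_turan nu x Hx)) as [E1 D1].
  auto_derive.
  { repeat split; trivial. apply Rgt_not_eq, Rmult_lt_0_compat; nra. }
  replace (Derive (fun x0 => scaled_turan nu x0) x) with (Derive (scaled_turan nu) x)
    by reflexivity.
  replace (Derive (fun x0 => Kim nu x0) x) with (Derive (Kim nu) x) by reflexivity.
  rewrite D0, D1. unfold slope_factor. field. split; trivial. lra.
Qed.

(** Since [D' = - 2 x f^2], the terms [D' (1 + x f' / f)] and [(x^2 f^2)'] cancel;
    what is left is [D (x f' / f)'], and [(x f' / f)' = - D / (x f^2)] by the
    Bessel equation. *)
Lemma is_derive_slope_factor (nu x : R) : 0 < x -> Kim nu x <> 0 ->
  is_derive (slope_factor nu) x
    (- (scaled_turan nu x * scaled_turan nu x / (x * (Kim nu x * Kim nu x)))).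
Proof.
  intros Hx Hne.
  destruct (is_derive_ex_Derive _ _ _ (is_derive_Kim nu x Hx)) as [E0 D0].
  destruct (is_derive_ex_Derive _ _ _ (is_derive_scaled_turan nu x Hx)) as [E1 D1].
  pose proof (bessel_equation nu x Hx) as Hp.
  remember (fun x : R => x * dKim nu x) as p eqn:Ep in Hp.
  destruct (is_derive_ex_Derive _ _ _ Hp) as [E2 D2].
  apply (is_derive_ext (fun x => scaled_turan nu x * (1 + p x / Kim nu x)
                                 + x * x * (Kim nu x * Kim nu x))).
  { intros y. now rewrite Ep. }
  auto_derive; [repeat split; assumption |].
  replace (Derive (fun x0 => scaled_turan nu x0) x) with (Derive (scaled_turan nu) x)
    by reflexivity.
  replace (Derive (fun x0 => p x0) x) with (Derive p x) by reflexivity.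
  replace (Derive (fun x0 => Kim nu x0) x) with (Derive (Kim nu) x) by reflexivity.
  rewrite D0, D1, D2, Ep. unfold scaled_turan. field. split; trivial. lra.
Qed.

Lemma slope_factor_decreasing (nu x y : R) : 0 < x -> x < y ->
  (forall t : R, x <= t <= y -> Kim nu t <> 0) -> slope_factor nu y < slope_factor nu x.
Proof.
  intros Hx Hxy Hne.
  destruct (MVT_gen (slope_factor nu) x y
    (fun t => - (scaled_turan nu t * scaled_turan nu t / (t * (Kim nu t * Kim nu t)))))
    as [c [Hc E]].
  - rewrite Rmin_left, Rmax_right by lra. intros t Ht.
    apply is_derive_slope_factor; [lra | apply Hne; lra].
  - rewrite Rmin_left, Rmax_right by lra. intros t Ht.
    eapply is_derive_continuity, is_derive_slope_factor; [lra | apply Hne; lra].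
  - rewrite Rmin_left, Rmax_right in Hc by lra.
    pose proof (scaled_turan_pos nu c ltac:(lra)). pose proof (Hne c Hc).
    assert (0 < scaled_turan nu c * scaled_turan nu c / (c * (Kim nu c * Kim nu c))).
    { apply Rdiv_lt_0_compat; [nra | apply Rmult_lt_0_compat; nra]. }
    nra.
Qed.

(** [K_{i nu}] keeps one sign on the gap, so it leaves its zero at [a] and enters
    its zero at [b] on the same side. *)
Lemma dKim_opposite_signs (nu a b : R) : 0 < a -> a < b -> Kim nu a = 0 -> Kim nu b = 0 ->
  (forall t : R, a < t < b -> Kim nu t <> 0) -> dKim nu a * dKim nu b < 0.
Proof.
  intros Ha Hab Ea Eb Hne.
  destruct (is_derive_sign_near _ a _ (is_derive_Kim nu a Ha) Ea (dKim_neq_0 nu a Ha Ea))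
    as [d [Hd Hsa]].
  assert (Hb : 0 < b) by lra.
  destruct (is_derive_sign_near _ b _ (is_derive_Kim nu b Hb) Eb (dKim_neq_0 nu b Hb Eb))
    as [d' [Hd' Hsb]].
  set (h := Rmin (Rmin d d') (b - a) / 2).
  pose proof (Rmin_l (Rmin d d') (b - a)). pose proof (Rmin_r (Rmin d d') (b - a)).
  pose proof (Rmin_l d d'). pose proof (Rmin_r d d').
  assert (0 < Rmin (Rmin d d') (b - a)) by (repeat apply Rmin_pos; lra).
  assert (Hh : 0 < h) by (unfold h; lra).
  assert (Hhd : h < d /\ h < d' /\ h < b - a) by (unfold h; lra).
  specialize (Hsa (a + h) ltac:(lra)). specialize (Hsb (b - h) ltac:(lra)).
  replace (a + h - a) with h in Hsa by ring. replace (b - h - b) with (- h) in Hsb by ring.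
  rewrite Rabs_Ropp in Hsb. rewrite Rabs_right in Hsa, Hsb by lra.
  specialize (Hsa ltac:(lra)). specialize (Hsb ltac:(lra)).
  pose proof (Kim_same_sign nu a b (a + h) (b - h) Ha Hne ltac:(lra) ltac:(lra)) as Hs.
  set (u := Kim nu (a + h)) in *. set (v := Kim nu (b - h)) in *.
  assert (B1 : 0 < dKim nu a * u). { apply Rmult_lt_reg_r with h; lra. }
  assert (B2 : dKim nu b * v < 0). { apply Rmult_lt_reg_r with h; lra. }
  assert (B3 : 0 < dKim nu a * u * - (dKim nu b * v)) by (apply Rmult_lt_0_compat; lra).
  apply Rmult_lt_reg_r with (u * v); lra.
Qed.

(** Multiplied by [K_{i nu}], the slope factor extends continuously to the zeros
    [a] and [b], where its values [a * D(a) * f'(a)] and [b * D(b) * f'(b)] have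
    opposite signs. *)
Lemma slope_factor_zero (nu a b : R) : 0 < a -> a < b -> Kim nu a = 0 -> Kim nu b = 0 ->
  (forall t : R, a < t < b -> Kim nu t <> 0) ->
  exists c : R, a < c < b /\ slope_factor nu c = 0.
Proof.
  intros Ha Hab Ea Eb Hne.
  destruct (ivt_of_opposite_signs
    (fun x => scaled_turan nu x * (Kim nu x + x * dKim nu x)
              + x * x * (Kim nu x * Kim nu x * Kim nu x)) a b Hab) as [c [Hc E]].
  - intros x Hx. assert (Hx0 : 0 < x) by lra.
    pose proof (is_derive_continuity _ _ _ (is_derive_scaled_turan nu x Hx0)) as C1.
    pose proof (is_derive_continuity _ _ _ (bessel_equation nu x Hx0)) as C2.
    pose proof (Kim_continuity nu x Hx0) as C0.
    pose proof (continuity_pt_id x) as CI.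
    apply (continuity_pt_plus
      (fun x => scaled_turan nu x * (Kim nu x + x * dKim nu x))
      (fun x => x * x * (Kim nu x * Kim nu x * Kim nu x))).
    + apply (continuity_pt_mult (scaled_turan nu) (fun x => Kim nu x + x * dKim nu x)); trivial.
      now apply (continuity_pt_plus (Kim nu) (fun x => x * dKim nu x)).
    + apply (continuity_pt_mult (fun x => x * x) (fun x => Kim nu x * Kim nu x * Kim nu x)).
      * now apply (continuity_pt_mult id id).
      * apply (continuity_pt_mult (fun x => Kim nu x * Kim nu x) (Kim nu)); trivial.
        now apply (continuity_pt_mult (Kim nu) (Kim nu)).
  - rewrite Ea, Eb.
    pose proof (dKim_opposite_signs nu a b Ha Hab Ea Eb Hne) as Hs.
    pose proof (scaled_turan_pos nu a Ha) as Da.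
    pose proof (scaled_turan_pos nu b ltac:(lra)) as Db.
    assert (Hw : 0 < scaled_turan nu a * a * (scaled_turan nu b * b)).
    { repeat apply Rmult_lt_0_compat; lra. }
    assert (0 < scaled_turan nu a * a * (scaled_turan nu b * b) * - (dKim nu a * dKim nu b)).
    { apply Rmult_lt_0_compat; lra. }
    lra.
  - exists c. split; trivial. pose proof (Hne c Hc) as Hk.
    apply Rmult_eq_reg_r with (Kim nu c); trivial.
    rewrite Rmult_0_l, <- E. unfold slope_factor. field. trivial.
Qed.

Lemma Tnu_mean_value (nu a b x y : R) : 0 < a ->
  (forall t : R, a < t < b -> Kim nu t <> 0) -> a < x -> x < y -> y < b ->
  exists z : R, x < z < y /\ 0 < z * z * z * (Kim nu z * Kim nu z) /\
    Tnu nu y - Tnu nu x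
    = - (2 * slope_factor nu z / (z * z * z * (Kim nu z * Kim nu z))) * (y - x).
Proof.
  intros Ha Hne Hx Hxy Hy.
  destruct (MVT_cor2 (Tnu nu)
    (fun z => - (2 * slope_factor nu z / (z * z * z * (Kim nu z * Kim nu z)))) x y Hxy)
    as [z [E Hz]].
  - intros t Ht. apply is_derive_Reals, is_derive_Tnu; [lra | apply Hne; lra].
  - exists z. split; [exact Hz | split; [| exact E]].
    pose proof (Hne z ltac:(lra)) as Hk.
    apply Rmult_lt_0_compat; [| exact (Rlt_0_sqr _ Hk)].
    repeat apply Rmult_lt_0_compat; lra.
Qed.

Definition strict_minimum_in_gap (nu a b c : R) : Prop :=
  a < c < b /\ slope_factor nu c = 0 /\
  (forall x : R, a < x < b -> is_derive (Tnu nu) x 0 -> x = c) /\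
  (forall x : R, a < x < b -> x <> c -> Tnu nu c < Tnu nu x).

(** The slope factor is strictly decreasing with exactly one zero, so [T_nu]
    strictly decreases before that zero and strictly increases after it. *)
Lemma gap_minimum (nu a b : R) : 0 < a -> a < b -> Kim nu a = 0 -> Kim nu b = 0 ->
  (forall t : R, a < t < b -> Kim nu t <> 0) ->
  exists c : R, strict_minimum_in_gap nu a b c.
Proof.
  intros Ha Hab Ea Eb Hne.
  destruct (slope_factor_zero nu a b Ha Hab Ea Eb Hne) as [c [Hc Pc]].
  assert (Hlt : forall x, a < x < c -> 0 < slope_factor nu x).
  { intros x Hx. rewrite <- Pc. apply slope_factor_decreasing; try lra.
    intros t Ht. apply Hne. lra. }
  assert (Hgt : forall x, c < x < b -> slope_factor nu x < 0).
  { intros x Hx. rewrite <- Pc. apply slope_factor_decreasing; try lra.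
    intros t Ht. apply Hne. lra. }
  exists c. split; [exact Hc | split; [exact Pc | split]].
  - intros x Hx Hx0. apply is_derive_unique in Hx0.
    pose proof (Hne x Hx) as Hk.
    rewrite (is_derive_unique _ _ _ (is_derive_Tnu nu x ltac:(lra) Hk)) in Hx0.
    assert (Px : slope_factor nu x = 0).
    { apply Rmult_eq_reg_r with (- (2 / (x * x * x * (Kim nu x * Kim nu x)))).
      - rewrite Rmult_0_l, <- Hx0. unfold Rdiv. ring.
      - apply Ropp_neq_0_compat. unfold Rdiv.
        apply Rmult_integral_contrapositive_currified; [lra |].
        apply Rinv_neq_0_compat.
        repeat apply Rmult_integral_contrapositive_currified; trivial; lra. }
    destruct (Rtotal_order x c) as [H | [H | H]]; trivial.
    + pose proof (Hlt x ltac:(lra)). lra.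
    + pose proof (Hgt x ltac:(lra)). lra.
  - intros x Hx Hxc. destruct (Rtotal_order x c) as [H | [H | H]]; [| contradiction |].
    + destruct (Tnu_mean_value nu a b x c Ha Hne) as [z [Hz [Hd E]]]; try lra.
      assert (Hp : 0 < 2 * slope_factor nu z) by (pose proof (Hlt z); lra).
      pose proof (Rdiv_lt_0_compat _ _ Hp Hd). nra.
    + destruct (Tnu_mean_value nu a b c x Ha Hne) as [z [Hz [Hd E]]]; try lra.
      assert (Hp : 0 < - (2 * slope_factor nu z)) by (pose proof (Hgt z); lra).
      pose proof (Rdiv_lt_0_compat _ _ Hp Hd). unfold Rdiv in *. nra.
Qed.

(** At a critical point [x K' / K = - 1 - 1 / T]; inserting this in
    [x^2 (T + 1) = (x K' / K)^2 + nu^2] leaves a relation between [x] and [T] in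
    which [x] decreases as [T] grows. *)
Lemma Tnu_critical_relation (nu c : R) : 0 < c -> Kim nu c <> 0 -> slope_factor nu c = 0 ->
  c * c * (Tnu nu c + 1) = (1 + / Tnu nu c) * (1 + / Tnu nu c) + nu * nu.
Proof.
  intros Hc Hne HP.
  pose proof (scaled_turan_pos nu c Hc) as HD.
  assert (Hy : c * dKim nu c / Kim nu c = - (1 + / Tnu nu c)).
  { rewrite TnuE by trivial. unfold slope_factor in HP.
    apply Rmult_eq_reg_l with (scaled_turan nu c); [| lra].
    replace (scaled_turan nu c *
      - (1 + / (scaled_turan nu c / (c * c * (Kim nu c * Kim nu c)))))
      with (- scaled_turan nu c - c * c * (Kim nu c * Kim nu c)).
    - lra.
    - field. repeat split; trivial; lra. }
  replace ((1 + / Tnu nu c) * (1 + / Tnu nu c))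
    with (c * dKim nu c / Kim nu c * (c * dKim nu c / Kim nu c)) by (rewrite Hy; ring).
  rewrite TnuE by trivial. unfold scaled_turan. field. split; trivial. lra.
Qed.

Lemma critical_values_increase (nu c c' t t' : R) : 0 < c' -> c' < c -> 0 < t -> 0 < t' ->
  c * c * (t + 1) = (1 + / t) * (1 + / t) + nu * nu ->
  c' * c' * (t' + 1) = (1 + / t') * (1 + / t') + nu * nu -> t < t'.
Proof.
  intros Hc' Hc Ht Ht' E E'. apply Rnot_le_lt. intros Hle.
  pose proof (Rinv_le_contravar _ _ Ht' Hle) as Hi.
  pose proof (Rinv_0_lt_compat _ Ht).
  assert ((1 + / t) * (1 + / t) <= (1 + / t') * (1 + / t')) by (apply Rmult_le_compat; lra).
  assert (c' * c' < c * c) by nra.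
  assert (c' * c' * (t' + 1) < c * c * (t + 1)) by (apply Rmult_le_0_lt_compat; nra).
  lra.
Qed.

Lemma critical_values_large (nu M : R) : 0 < nu -> 0 < M ->
  exists e : R, 0 < e /\ forall c t : R, 0 < c -> c < e -> 0 < t ->
    c * c * (t + 1) = (1 + / t) * (1 + / t) + nu * nu -> M < t.
Proof.
  intros Hnu HM.
  assert (Hq : 0 < nu * nu / (M + 1)) by (apply Rdiv_lt_0_compat; nra).
  (* below this bound [c * c <= c < nu^2 / (M + 1)], while [t <= M] would force
     [nu^2 < c * c * (M + 1)] *)
  exists (Rmin 1 (nu * nu / (M + 1))). split. { apply Rmin_pos; lra. }
  intros c t Hc Hce Ht E. apply Rnot_le_lt. intros Hle.
  pose proof (Rmin_l 1 (nu * nu / (M + 1))). pose proof (Rmin_r 1 (nu * nu / (M + 1))).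
  assert (Hcc : c * c < nu * nu / (M + 1)) by nra.
  assert (Hm : c * c * (M + 1) < nu * nu).
  { apply (Rmult_lt_compat_r (M + 1)) in Hcc; [| lra].
    replace (nu * nu / (M + 1) * (M + 1)) with (nu * nu) in Hcc by (field; lra). lra. }
  pose proof (Rinv_0_lt_compat _ Ht). nra.
Qed.

(** * The zeros [kappa] *)

(** The supremum of the zeros satisfying [Q] is itself a zero by continuity, and
    satisfies [Q] as it is at most [U]; the bound [U] keeps it away from the
    possibly excluded upper end of the range of [Q]. *)
Lemma greatest_zero_below (nu U : R) (Q E : R -> Prop) : 0 < nu -> 0 < U ->
  (forall x : R, E x <-> 0 < x /\ Kim nu x = 0 /\ Q x) ->
  (forall x : R, 0 < x -> x <= U -> Q x) ->
  (forall x : R, 0 < x -> Kim nu x = 0 -> Q x -> x <= U) ->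
  0 < real (Lub_Rbar E) <= U /\ Kim nu (real (Lub_Rbar E)) = 0 /\
  (forall x : R, 0 < x -> Kim nu x = 0 -> Q x -> x <= real (Lub_Rbar E)).
Proof.
  intros Hnu HU HE HQ Hub. set (s := real (Lub_Rbar E)).
  destruct (arbitrarily_small_zeros nu U Hnu HU) as [z [Hz Ez]].
  assert (HzE : E z). { apply HE. repeat split; try tauto. apply HQ; lra. }
  destruct (Lub_Rbar_correct E) as [H1 H2].
  assert (HbU : is_ub_Rbar E U).
  { intros x Hx. apply HE in Hx. destruct Hx as [Hx [Hk Hq]]. now apply Hub. }
  assert (Hfin : Lub_Rbar E = Finite s).
  { pose proof (H1 z HzE) as Hlo. pose proof (H2 _ HbU) as Hhi.
    unfold s. destruct (Lub_Rbar E); simpl in *; tauto. }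
  rewrite Hfin in H1, H2.
  assert (Hzs : z <= s) by exact (H1 z HzE).
  assert (HsU : s <= U) by exact (H2 _ HbU).
  split; [lra | split].
  - apply NNPP. intros Hne.
    destruct (continuity_pt_nonzero_near _ s (Kim_continuity nu s ltac:(lra)) Hne)
      as [d [Hd Hnz]].
    assert (Hb : is_ub_Rbar E (s - d)).
    { intros x Hx. pose proof (H1 x Hx) as Hxs. simpl in Hxs |- *.
      apply HE in Hx. destruct Hx as [Hx [Hk _]].
      apply Rnot_lt_le. intros Hlt. apply (Hnz x); trivial.
      apply Rabs_lt_between. lra. }
    pose proof (H2 _ Hb) as H. simpl in H. lra.
  - intros x Hx Hk Hq. apply (H1 x), HE. auto.
Qed.

Lemma kappa_set (nu : R) (Q : R -> Prop) (x : R) :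
  0 < x /\ BesselK (Ci * RtoC nu)%C x = RtoC 0 /\ Q x <->
  0 < x /\ Kim nu x = 0 /\ Q x.
Proof.
  split; intros [Hx [Hz Hq]]; repeat split; trivial.
  - rewrite BesselK_imaginary in Hz by trivial. now apply RtoC_inj.
  - rewrite BesselK_imaginary by trivial. now rewrite Hz.
Qed.

(** No zero exceeds [4 nu^2], which bounds the first one; each zero is isolated,
    which keeps the supremum of the smaller ones strictly below it. *)
Lemma kappa_spec (nu : R) (n : nat) : 0 < nu ->
  0 < kappa nu (S n) /\ Kim nu (kappa nu (S n)) = 0 /\
  (n = O \/ kappa nu (S n) < kappa nu n) /\
  (forall x : R, 0 < x -> Kim nu x = 0 -> n = O \/ x < kappa nu n -> x <= kappa nu (S n)).
Proof.
  intros Hnu. induction n as [|n IH].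
  - assert (H : 0 < kappa nu 1 <= 4 * (nu * nu) /\ Kim nu (kappa nu 1) = 0 /\
      (forall x, 0 < x -> Kim nu x = 0 -> 0%nat = 0%nat \/ x < kappa nu 0 -> x <= kappa nu 1)).
    { apply greatest_zero_below; trivial.
      - nra.
      - intros x. apply (kappa_set nu (fun x => 0%nat = 0%nat \/ x < kappa nu 0)).
      - intros x _ _. now left.
      - intros x Hx Hk _. apply Rnot_lt_le. intros Hlt.
        pose proof (Kim_pos nu x Hx Hlt). lra. }
    destruct H as [Hs [Hk Hmax]].
    split; [apply Hs | split; [exact Hk | split; [now left | exact Hmax]]].
  - destruct IH as [Hp [Hz _]].
    destruct (zeros_isolated nu (kappa nu (S n)) Hp) as [d [Hd Hiso]].
    set (k := kappa nu (S n)) in *.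
    set (U := Rmax (k / 2) (k - d)).
    pose proof (Rmax_l (k / 2) (k - d)). pose proof (Rmax_r (k / 2) (k - d)).
    assert (HUk : U < k) by (unfold U; apply Rmax_lub_lt; lra).
    assert (H1 : 0 < kappa nu (S (S n)) <= U /\ Kim nu (kappa nu (S (S n))) = 0 /\
      (forall x, 0 < x -> Kim nu x = 0 -> S n = O \/ x < k -> x <= kappa nu (S (S n)))).
    { apply greatest_zero_below; trivial.
      - unfold U; lra.
      - intros x. apply (kappa_set nu (fun x => S n = O \/ x < k)).
      - intros x _ Hx. right. lra.
      - intros x Hx Hk [E | Hlt]; [discriminate E |].
        apply Rnot_lt_le. intros HU. apply (Hiso x); trivial; [lra |].
        apply Rabs_lt_between. unfold U in HU. lra. }
    destruct H1 as [Hs [Hk Hmax]].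
    split; [apply Hs | split; [exact Hk | split; [right; lra | exact Hmax]]].
Qed.

Lemma kappa_gap (nu : R) (n : nat) : 0 < nu -> (1 <= n)%nat ->
  0 < kappa nu (S n) /\ kappa nu (S n) < kappa nu n /\
  Kim nu (kappa nu (S n)) = 0 /\ Kim nu (kappa nu n) = 0 /\
  (forall x : R, zero_gap nu n x -> Kim nu x <> 0).
Proof.
  intros Hnu Hn. destruct n as [|n]; [lia |].
  destruct (kappa_spec nu n Hnu) as [_ [Hk _]].
  destruct (kappa_spec nu (S n) Hnu) as [Hp [Hk' [Hlt Hmax]]].
  destruct Hlt as [Hlt | Hlt]; [discriminate Hlt |].
  repeat split; trivial.
  intros x [Hx1 Hx2] Hx.
  pose proof (Hmax x ltac:(lra) Hx (or_intror Hx2)). lra.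
Qed.

(** The zeros would otherwise accumulate at their positive limit. *)
Lemma kappa_small (nu e : R) : 0 < nu -> 0 < e ->
  exists N : nat, forall n : nat, (N <= n)%nat -> kappa nu (S n) < e.
Proof.
  intros Hnu He.
  assert (Hdec : forall n, kappa nu (S (S n)) < kappa nu (S n)).
  { intros n. apply (kappa_gap nu (S n) Hnu). lia. }
  assert (Hpos : forall n, 0 < kappa nu (S n)) by (intros n; now apply kappa_spec).
  destruct (ex_finite_lim_seq_decr (fun n => kappa nu (S n)) 0) as [l Hl].
  { intros n. apply Rlt_le, Hdec. }
  { intros n. apply Rlt_le, Hpos. }
  assert (Hgt : forall n, l < kappa nu (S n)).
  { intros n. apply Rle_lt_trans with (kappa nu (S (S n))); [| apply Hdec].
    apply (is_lim_seq_decr_compare _ l Hl) with (n := S n).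
    intros m. apply Rlt_le, Hdec. }
  assert (Hl0 : l <= 0).
  { apply Rnot_lt_le. intros Hl0. destruct (zeros_isolated nu l Hl0) as [d [Hd Hiso]].
    apply is_lim_seq_spec in Hl. destruct (Hl (mkposreal d Hd)) as [N HN].
    apply (Hiso (kappa nu (S N))).
    - pose proof (Hgt N). lra.
    - exact (HN N (Nat.le_refl N)).
    - apply kappa_spec, Hnu. }
  apply is_lim_seq_spec in Hl. destruct (Hl (mkposreal e He)) as [N HN].
  exists N. intros n Hn. specialize (HN n Hn).
  change (Rabs (kappa nu (S n) - l) < e) in HN. apply Rabs_lt_between in HN. lra.
Qed.

(** * The minima *)

Lemma turan_boundE (nu c x : R) : 0 < x -> Kim nu x <> 0 ->
  turan_bound nu c x <-> c <= Tnu nu x.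
Proof.
  intros Hx Hne. rewrite TnuE by trivial. unfold turan_bound, Cle.
  rewrite BesselK_imaginary, BesselK_imaginary_add1, BesselK_imaginary_sub1 by trivial.
  assert (Hf : 0 < Kim nu x * Kim nu x) by nra.
  assert (E : scaled_turan nu x / (x * x * (Kim nu x * Kim nu x)) * (Kim nu x * Kim nu x)
    = dKim nu x * dKim nu x + nu / x * Kim nu x * (nu / x * Kim nu x)
      - Kim nu x * Kim nu x).
  { unfold scaled_turan. field. split; trivial. lra. }
  simpl. split.
  - intros [_ H]. apply Rmult_le_reg_r with (Kim nu x * Kim nu x); lra.
  - intros H. apply (Rmult_le_compat_r (Kim nu x * Kim nu x)) in H; [| lra].
    split; [ring | lra].
Qed.

Theorem theorem4 : forall nu : R, 0 < nu ->
  exists alpha : nat -> R,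
    (forall n : nat, (1 <= n)%nat ->
       unique (critical_point_on (zero_gap nu n) (Tnu nu)) (alpha n) /\
       unique (minimum_point_on (zero_gap nu n) (Tnu nu)) (alpha n)) /\
    let tau := fun n : nat => Tnu nu (alpha n) in
    0 < tau 1%nat /\
    (forall n : nat, (1 <= n)%nat -> tau n < tau (S n)) /\
    is_lim_seq tau p_infty /\
    (forall n : nat, (1 <= n)%nat ->
       (forall x : R, zero_gap nu n x -> turan_bound nu (tau n) x) /\
       (forall c : R, (forall x : R, zero_gap nu n x -> turan_bound nu c x) ->
          c <= tau n)).
Proof.
  intros nu Hnu.
  set (P := fun n => strict_minimum_in_gap nu (kappa nu (S n)) (kappa nu n)).
  set (alpha := fun n => epsilon (inhabits 0) (P n)).
  exists alpha.
  assert (Halpha : forall n, (1 <= n)%nat -> P n (alpha n)).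
  { intros n Hn. apply epsilon_spec.
    destruct (kappa_gap nu n Hnu Hn) as [Hp [Hlt [Hk [Hk' Hne]]]].
    now apply gap_minimum. }
  assert (Hgap : forall n x, (1 <= n)%nat -> zero_gap nu n x -> 0 < x /\ Kim nu x <> 0).
  { intros n x Hn Hx. destruct (kappa_gap nu n Hnu Hn) as [Hp [_ [_ [_ Hne]]]].
    split; [| now apply Hne]. destruct Hx. lra. }
  assert (Hpos : forall n, (1 <= n)%nat -> 0 < alpha n /\ 0 < Tnu nu (alpha n)).
  { intros n Hn. destruct (Halpha n Hn) as [Hc _].
    destruct (Hgap n _ Hn Hc) as [H0 Hne]. split; trivial. now apply Tnu_pos. }
  assert (Hrel : forall n, (1 <= n)%nat ->
    alpha n * alpha n * (Tnu nu (alpha n) + 1)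
    = (1 + / Tnu nu (alpha n)) * (1 + / Tnu nu (alpha n)) + nu * nu).
  { intros n Hn. destruct (Halpha n Hn) as [Hc [HP _]].
    destruct (Hgap n _ Hn Hc) as [H0 Hne]. now apply Tnu_critical_relation. }
  assert (Hmin : forall n x, (1 <= n)%nat -> zero_gap nu n x ->
    Tnu nu (alpha n) <= Tnu nu x).
  { intros n x Hn Hx. destruct (Halpha n Hn) as [_ [_ [_ Hlt]]].
    destruct (Req_dec x (alpha n)) as [-> | Hne]; [lra |]. now apply Rlt_le, Hlt. }
  split.
  - intros n Hn. destruct (Halpha n Hn) as [Hc [HP [Hcrit Hlt]]].
    destruct (Hgap n _ Hn Hc) as [H0 Hne]. split; split.
    + split; [exact Hc |].
      replace 0 with (- (2 * slope_factor nu (alpha n) /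
        (alpha n * alpha n * alpha n * (Kim nu (alpha n) * Kim nu (alpha n)))))
        by (rewrite HP; unfold Rdiv; ring).
      now apply is_derive_Tnu.
    + intros x [Hx Hd]. symmetry. now apply Hcrit.
    + split; [exact Hc |]. intros x Hx. now apply Hmin.
    + intros x [Hx Hm]. apply NNPP. intros Hxc.
      pose proof (Hlt x Hx ltac:(auto)). pose proof (Hm _ Hc). lra.
  - intros tau. split; [| split; [| split]].
    + now apply Hpos.
    + intros n Hn. destruct (Halpha n Hn) as [Hc _].
      destruct (Halpha (S n) ltac:(lia)) as [Hc' _].
      destruct (Hpos n Hn), (Hpos (S n) ltac:(lia)).
      apply (critical_values_increase nu (alpha n) (alpha (S n))); trivial; [lra | |];
        apply Hrel; lia.
    + apply is_lim_seq_spec. intros M.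
      destruct (critical_values_large nu (Rmax M 1) Hnu) as [e [He Hlarge]].
      { pose proof (Rmax_r M 1). lra. }
      destruct (kappa_small nu e Hnu He) as [N HN].
      exists (S N). intros n Hn. destruct n as [|n]; [lia |].
      destruct (Halpha (S n) ltac:(lia)) as [Hc _].
      destruct (Hpos (S n) ltac:(lia)) as [Ha Ht].
      apply Rle_lt_trans with (Rmax M 1); [apply Rmax_l |].
      apply Hlarge with (alpha (S n)); trivial.
      * pose proof (HN n ltac:(lia)). lra.
      * apply Hrel. lia.
    + intros n Hn. split.
      * intros x Hx. destruct (Hgap n x Hn Hx).
        apply (turan_boundE nu (tau n) x); trivial. now apply Hmin.
      * intros c Hc. destruct (Halpha n Hn) as [Ha _]. destruct (Hgap n _ Hn Ha).
        apply (turan_boundE nu c (alpha n)); trivial. now apply Hc.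
Qed.
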